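(* Let $\{c_\ell\}_{\ell\ge0}$ be constants with $|c_\ell|\le ce^{b\ell}$ for some $c,b>0$, and let $f(r,s):=\sum_{\ell=0}^\infty c_\ell u_\ell(r)u_\ell(s)$. Suppose that the equation $$K(r,s)=f(r,s)-\int_0^rK(r,t)f(t,s)\,t^{-2}\,dt,\qquad0\le s\le r,$$ is uniquely solvable for all $r>0$. Then $K(r,s)$ is an analytic function of $r$ and $s$ in a neighborhood $\Delta$ of the positive semiaxis $(0,\infty)$ in the complex plane of the variables $r$ and $s$.
   Context: $u_\ell(r):=\sqrt{\frac{\pi r}2}\,J_{\ell+1/2}(r)$, where $J_\nu$ is the Bessel function. For each fixed $r>0$ the integral equation is regarded as a Fredholm equation for $K(r,\cdot)$ in the space of continuous functions on $(0,r)$, with $K(r,0)=0$ (note $f(r,0)=f(0,s)=0$). *)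

(* Defs.v *)
From Stdlib Require Import Reals Factorial.
From Coquelicot Require Import Coquelicot.

Open Scope R_scope.

(* Euler's integral, meaningful for x > 0. *)
Definition Gamma (x : R) : R :=
  RInt_gen (fun t : R => Rpower t (x - 1) * exp (- t))
    (at_right 0) (Rbar_locally p_infty).

(* Bessel function of the first kind, for nu > -1 and r > 0.  At r = 0 the value
   is junk, since Rpower 0 y = 1. *)
Definition BesselJ (nu r : R) : R :=
  Series (fun k : nat =>
    (-1) ^ k / (INR (fact k) * Gamma (INR k + nu + 1))
    * Rpower (r / 2) (2 * INR k + nu)).

(* The factor sqrt r makes u l 0 = 0, whatever BesselJ is at 0. *)
Definition u (l : nat) (r : R) : R :=
  sqrt (PI * r / 2) * BesselJ (INR l + / 2) r.

(* The sum over l of c l * u l r * u l s, with complex c l: as u is real, the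
   real and imaginary parts are summed separately. *)
Definition f (c : nat -> C) (r s : R) : C :=
  (Series (fun l : nat => Re (c l) * u l r * u l s),
   Series (fun l : nat => Im (c l) * u l r * u l s)).

(* k = K(r,.) solves the integral equation on [0,r].  The factor t^-2 is singular
   at 0, so the integral is improper there and its convergence is part of being
   a solution. *)
Definition solves (c : nat -> C) (r : R) (k : R -> C) : Prop :=
  continuous_on (fun s : R => 0 <= s <= r) k /\
  k 0 = RtoC 0 /\
  forall s : R, 0 <= s <= r ->
    exists I : C,
      is_RInt_gen (V := C_R_NormedModule)
        (fun t : R => (k t * f c t s * RtoC (/ t ^ 2))%C)
        (at_right 0) (at_point r) I /\
      k s = (f c r s - I)%C.

(* Only the values on [0,r] count in the comparison of two solutions. *)
Definition uniquely_solvable (c : nat -> C) (r : R) : Prop :=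
  exists k : R -> C, solves c r k /\
    forall k' : R -> C, solves c r k' ->
      forall s : R, 0 <= s <= r -> k' s = k s.

(* Absolute convergence of a double series, with sum v. *)
Definition is_double_series (a : nat -> nat -> C) (v : C) : Prop :=
  (exists M : R, forall n : nat,
     sum_n (fun i => sum_n (fun j => Cmod (a i j)) n) n <= M) /\
  filterlim (fun n : nat => sum_n (fun i => sum_n (fun j => a i j) n) n)
    eventually (locally v).

Definition analytic2_at (F : C -> C -> C) (z0 w0 : C) : Prop :=
  exists (a : nat -> nat -> C) (rho : R), 0 < rho /\
    forall z w : C, Cmod (z - z0) < rho -> Cmod (w - w0) < rho ->
      is_double_series
        (fun i j => (a i j * (z - z0) ^ i * (w - w0) ^ j)%C) (F z w).

(* Main.v *)
Require Import Defs.
From Stdlib Require Import Reals Lra Lia Arith Classical ClassicalEpsilon.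
From Coquelicot Require Import Coquelicot.

Open Scope R_scope.

(* Put u_l(z) = z v_l(z), with v_l entire, and M_lm(z) = \int_0^z v_l v_m.  The
   ansatz K(z,w) = sum_l c_l a_l(z) u_l(w) turns the integral equation into the
   linear system (I + A(z)) a(z) = u(z) on bounded sequences, with A_lm = c_m M_lm.
   The coefficients of v_l decay faster than any exponential in l, so A(z) is an
   entire family of compact operators.  Unique solvability at r > 0 makes
   I + A(r) injective.  Where I + A(z) is injective it has an inverse that is
   analytic nearby (analytic Fredholm theorem), so Delta is the set of these z,
   and a(z), hence K, is analytic there; in w, K is even entire.

   Only power series are used.  To invert I + A near z0, split A into a finite
   number of columns and a tail of small norm: the tail is inverted by a Neumann
   series, and what is left is a finite linear system. *)

(** Complex analysis is replaced by norm estimates: with the Wiener norm of a disc, sums and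
    products need only the exchange of absolutely convergent sums, not Cauchy's formula or contour
    integrals. Thus M_lm is given by a double power series, and only its values on the nonnegative
    axis are identified with integrals.

    Compactness appears as a majorant: the entry (l,m) of A is bounded by [b m], independently of l,
    with [b] summable. Hence A acts on bounded sequences, and erasing finitely many columns leaves
    norm at most 1/2.

    Unique solvability concerns continuous functions, injectivity concerns sequences. The bridge: if
    (I + A(r)) x = 0, then k(s) = sum c_l x_l u_l(s) solves the homogeneous equation, so k = 0, and
    x_l = - \int_0^r k(t) t^-1 v_l(t) dt = 0. The integral recovers x_l even where c_l = 0. The
    singular t^-2 is harmless because k(t) and f(t,s) each contain a factor t.

    K is only given as a solution for each r separately, with no regularity in r. All of it comes
    from a(z), which uniqueness turns into one function on Delta. *)

Fixpoint rsum (x : nat -> R) (n : nat) : R :=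
  match n with O => 0 | S n => rsum x n + x n end.

Fixpoint csum (a : nat -> C) (n : nat) : C :=
  match n with O => RtoC 0 | S n => (csum a n + a n)%C end.

Lemma rsum_sum_n (x : nat -> R) (n : nat) : sum_n x n = rsum x (S n).
Proof.
  induction n as [|n IH].
  - rewrite sum_O; simpl; ring.
  - rewrite sum_Sn, IH; reflexivity.
Qed.

Lemma csum_sum_n (a : nat -> C) (n : nat) : sum_n a n = csum a (S n).
Proof.
  induction n as [|n IH].
  - rewrite sum_O; simpl; ring.
  - rewrite sum_Sn, IH; reflexivity.
Qed.

Lemma rsum_ext (x y : nat -> R) (n : nat) :
  (forall k, (k < n)%nat -> x k = y k) -> rsum x n = rsum y n.
Proof.
  induction n as [|n IH]; intros H; simpl; auto.
  rewrite IH, (H n); auto.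
Qed.

Lemma rsum_le (x y : nat -> R) (n : nat) :
  (forall k, (k < n)%nat -> x k <= y k) -> rsum x n <= rsum y n.
Proof.
  induction n as [|n IH]; intros H; simpl; [lra|].
  apply Rplus_le_compat; auto.
Qed.

Lemma rsum_pos (x : nat -> R) (n : nat) :
  (forall k, 0 <= x k) -> 0 <= rsum x n.
Proof.
  intros H; induction n as [|n IH]; simpl; [lra|]. specialize (H n); lra.
Qed.

Lemma rsum_mono (x : nat -> R) (n m : nat) :
  (forall k, 0 <= x k) -> (n <= m)%nat -> rsum x n <= rsum x m.
Proof.
  intros H Hnm; induction Hnm as [|m _ IH]; simpl; [lra|].
  specialize (H m); lra.
Qed.

Lemma rsum_term (x : nat -> R) (n : nat) :
  (forall k, 0 <= x k) -> x n <= rsum x (S n).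
Proof.
  intros H; simpl; pose proof (rsum_pos x n H); lra.
Qed.

Lemma rsum_scal (c : R) (x : nat -> R) (n : nat) :
  rsum (fun k => c * x k) n = c * rsum x n.
Proof. induction n as [|n IH]; simpl; [ring|rewrite IH; ring]. Qed.

Lemma rsum_plus (x y : nat -> R) (n : nat) :
  rsum (fun k => x k + y k) n = rsum x n + rsum y n.
Proof. induction n as [|n IH]; simpl; [ring|rewrite IH; ring]. Qed.

Lemma rsum_switch (x : nat -> nat -> R) (n m : nat) :
  rsum (fun i => rsum (x i) m) n = rsum (fun j => rsum (fun i => x i j) n) m.
Proof.
  induction n as [|n IH]; simpl.
  - induction m as [|m IH]; simpl; [|rewrite <- IH]; ring.
  - rewrite IH, <- rsum_plus; reflexivity.
Qed.

Lemma rsum_geom (q : R) (n : nat) : (1 - q) * rsum (pow q) n = 1 - q ^ n.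
Proof.
  induction n as [|n IH]; simpl; [ring|].
  rewrite Rmult_plus_distr_l, IH; ring.
Qed.

Lemma csum_ext (a b : nat -> C) (n : nat) :
  (forall k, (k < n)%nat -> a k = b k) -> csum a n = csum b n.
Proof.
  induction n as [|n IH]; intros H; simpl; auto.
  rewrite IH, (H n); auto.
Qed.

Lemma csum_plus (a b : nat -> C) (n : nat) :
  csum (fun k => (a k + b k)%C) n = (csum a n + csum b n)%C.
Proof. induction n as [|n IH]; simpl; [ring|rewrite IH; ring]. Qed.

Lemma csum_scal (c : C) (a : nat -> C) (n : nat) :
  csum (fun k => (c * a k)%C) n = (c * csum a n)%C.
Proof. induction n as [|n IH]; simpl; [ring|rewrite IH; ring]. Qed.

Lemma csum_zero (a : nat -> C) (n : nat) :
  (forall k, (k < n)%nat -> a k = 0) -> csum a n = 0.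
Proof.
  induction n as [|n IH]; intros H; simpl; auto.
  rewrite IH, (H n); auto; ring.
Qed.

Lemma csum_switch (a : nat -> nat -> C) (n m : nat) :
  csum (fun i => csum (a i) m) n = csum (fun j => csum (fun i => a i j) n) m.
Proof.
  induction n as [|n IH]; simpl.
  - symmetry; apply csum_zero; auto.
  - rewrite IH, <- csum_plus; reflexivity.
Qed.

Lemma csum_shift (a : nat -> C) (n : nat) :
  csum a (S n) = (a O + csum (fun k => a (S k)) n)%C.
Proof.
  induction n as [|n IH]; [simpl; ring|].
  replace (csum a (S (S n))) with (csum a (S n) + a (S n))%C by reflexivity.
  rewrite IH; simpl; ring.
Qed.

Lemma rsum_shift (a : nat -> R) (n : nat) :
  rsum a (S n) = a O + rsum (fun k => a (S k)) n.
Proof.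
  induction n as [|n IH]; [simpl; ring|].
  replace (rsum a (S (S n))) with (rsum a (S n) + a (S n)) by reflexivity.
  rewrite IH; simpl; ring.
Qed.

Lemma Cmod_csum (a : nat -> C) (n : nat) :
  Cmod (csum a n) <= rsum (fun k => Cmod (a k)) n.
Proof.
  induction n as [|n IH]; simpl; [rewrite Cmod_0; lra|].
  eapply Rle_trans; [apply Cmod_triangle|lra].
Qed.

Lemma csum_delta (a : nat -> C) (j n : nat) : (j < n)%nat ->
  csum (fun k => if Nat.eq_dec k j then a k else RtoC 0) n = a j.
Proof.
  induction n as [|n IH]; intros H; [lia|]; simpl.
  destruct (Nat.eq_dec n j) as [->|Hn].
  - rewrite csum_zero; [ring|].
    intros k Hk; destruct (Nat.eq_dec k j); [lia|auto].
  - rewrite IH by lia; ring.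
Qed.

(** * Nonnegative series with a bound *)

Definition bnd (x : nat -> R) (B : R) : Prop := forall n, rsum x n <= B.

Lemma bnd_pos (x : nat -> R) (B : R) : bnd x B -> 0 <= B.
Proof. intros H; exact (H O). Qed.

Lemma bnd_le (x : nat -> R) (B B' : R) : bnd x B -> B <= B' -> bnd x B'.
Proof. intros H HB n; specialize (H n); lra. Qed.

Lemma bnd_dom (x y : nat -> R) (B : R) :
  bnd y B -> (forall k, x k <= y k) -> bnd x B.
Proof.
  intros H Hxy n; eapply Rle_trans; [apply rsum_le; intros; apply Hxy|apply H].
Qed.

Lemma bnd_scal (x : nat -> R) (c B : R) :
  0 <= c -> bnd x B -> bnd (fun k => c * x k) (c * B).
Proof. intros Hc H n; rewrite rsum_scal; apply Rmult_le_compat_l; auto. Qed.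

Lemma bnd_term (x : nat -> R) (B : R) (n : nat) :
  (forall k, 0 <= x k) -> bnd x B -> x n <= B.
Proof. intros Hx H; eapply Rle_trans; [apply rsum_term; auto|apply H]. Qed.

Lemma bnd_geom : bnd (pow (/ 2)) 2.
Proof.
  intros n; pose proof (rsum_geom (/ 2) n).
  pose proof (pow_le (/ 2) n); lra.
Qed.

Lemma is_lim_seq_rsum (x : nat -> R) : ex_series x ->
  is_lim_seq (rsum x) (Series x).
Proof.
  intros H; apply is_lim_seq_incr_1.
  apply is_lim_seq_ext with (sum_n x); [intros; apply rsum_sum_n|].
  exact (Series_correct x H).
Qed.

Lemma bnd_ex_series (x : nat -> R) (B : R) :
  (forall k, 0 <= x k) -> bnd x B -> ex_series x.
Proof.
  intros Hx H.
  destruct (ex_finite_lim_seq_incr (fun n => rsum x (S n)) B) as [l Hl].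
  - intros n; apply rsum_mono; auto.
  - intros n; apply H.
  - exists l; apply filterlim_ext with (2 := Hl); intros; symmetry; apply rsum_sum_n.
Qed.

Lemma bnd_Series (x : nat -> R) (B : R) :
  (forall k, 0 <= x k) -> bnd x B -> Series x <= B.
Proof.
  intros Hx H.
  exact (is_lim_seq_le (rsum x) (fun _ => B) (Series x) B H
    (is_lim_seq_rsum x (bnd_ex_series x B Hx H)) (is_lim_seq_const B)).
Qed.

Lemma rsum_le_Series (x : nat -> R) (n : nat) :
  (forall k, 0 <= x k) -> ex_series x -> rsum x n <= Series x.
Proof.
  intros Hx H.
  refine (is_lim_seq_le_loc (fun _ => rsum x n) (rsum x) (rsum x n) (Series x) _
    (is_lim_seq_const _) (is_lim_seq_rsum x H)).
  exists n; intros m Hm; apply rsum_mono; auto.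
Qed.

(** The head is set to zero instead of shifting the index, so that the tail can bound a matrix whose
    first [N] columns are erased. *)
Lemma bnd_eventually_zero (x : nat -> R) (B : R) (eps : posreal) :
  (forall k, 0 <= x k) -> bnd x B ->
  exists N, bnd (fun k => if lt_dec k N then 0 else x k) eps.
Proof.
  intros Hx H.
  pose proof (is_lim_seq_rsum x (bnd_ex_series x B Hx H)) as Hl.
  apply is_lim_seq_spec in Hl; destruct (Hl eps) as [N HN]; exists N; intros n.
  assert (E : forall n, rsum (fun k => if lt_dec k N then 0 else x k) (N + n)%nat
                 = rsum x (N + n)%nat - rsum x N).
  { clear n; induction n as [|n IH].
    - rewrite Nat.add_0_r, Rminus_diag.
      rewrite (rsum_ext _ (fun k => 0 * x k)); [rewrite rsum_scal; ring|].
      intros k Hk; destruct (lt_dec k N); [ring|lia].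
    - rewrite Nat.add_succ_r; simpl; rewrite IH.
      destruct (lt_dec (N + n) N); [lia|ring]. }
  apply Rle_trans with (rsum (fun k => if lt_dec k N then 0 else x k) (N + n)%nat).
  - apply rsum_mono; [intros k; destruct lt_dec; [lra|apply Hx]|lia].
  - rewrite E.
    pose proof (rsum_le_Series x (N + n) Hx (bnd_ex_series x B Hx H)).
    specialize (HN N (le_n _)); apply Rabs_def2 in HN; lra.
Qed.

(* Dominated convergence for series of nonnegative terms tending to 0. *)
Lemma Series_dominated_zero (x : nat -> nat -> R) (b : nat -> R) (B : R) :
  (forall n k, 0 <= x n k <= b k) -> bnd b B ->
  (forall k, is_lim_seq (fun n => x n k) 0) ->
  is_lim_seq (fun n => Series (x n)) 0.
Proof.
  intros Hx Hb Hlim.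
  assert (b0 : forall k, 0 <= b k) by (intros k; specialize (Hx O k); lra).
  apply is_lim_seq_spec; intros eps.
  (* Split at [N]: the tail of the majorant is at most eps/2 for every [n], and the finite head
     tends to 0. *)
  destruct (bnd_eventually_zero b B (pos_div_2 eps) b0 Hb) as [N HN].
  assert (HL : is_lim_seq (fun n => rsum (x n) N) 0).
  { clear HN; induction N as [|N IH]; simpl; [apply is_lim_seq_const|].
    replace 0 with (0 + 0) by ring; apply is_lim_seq_plus'; auto. }
  apply is_lim_seq_spec in HL; destruct (HL (pos_div_2 eps)) as [M HM].
  exists M; intros n Hn; specialize (HM n Hn); simpl in *.
  rewrite Rminus_0_r in *.
  assert (E : bnd (x n) (rsum (x n) N + eps / 2)).
  { intros m. specialize (HN m); simpl in HN.
    enough (rsum (x n) m <= rsum (x n) N + rsum (fun k => if lt_dec k N then 0 else b k) m) by lra.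
    clear -Hx b0; induction m as [|m IH]; simpl.
    - pose proof (rsum_pos (x n) N (fun k => proj1 (Hx n k))); lra.
    - destruct (lt_dec m N) as [Hm|Hm].
      + enough (rsum (x n) m + x n m <= rsum (x n) N).
        { pose proof (rsum_pos (fun k => if lt_dec k N then 0 else b k) m).
          assert (0 <= rsum (fun k => if lt_dec k N then 0 else b k) m); [|lra].
          apply H0; intros k; destruct lt_dec; [lra|auto]. }
        apply (rsum_mono (x n) (S m) N (fun k => proj1 (Hx n k))); lia.
      + specialize (Hx n m); lra. }
  assert (H0 := bnd_Series _ _ (fun k => proj1 (Hx n k)) E).
  assert (H1 := rsum_le_Series (x n) O (fun k => proj1 (Hx n k))
    (bnd_ex_series _ _ (fun k => proj1 (Hx n k)) E)).
  simpl in H1; rewrite Rabs_pos_eq by lra.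
  apply Rabs_def2 in HM; lra.
Qed.

(** * Absolutely convergent complex series *)

(** Real and imaginary parts are summed separately, as in [f], so that the two can be compared
    termwise. The value is meaningful only under a convergence hypothesis such as [absum]. *)
Definition Csum (a : nat -> C) : C :=
  (Series (fun n => Re (a n)), Series (fun n => Im (a n))).

Definition absum (a : nat -> C) (B : R) : Prop := bnd (fun k => Cmod (a k)) B.

(** A real null sequence of moduli, so that limits in C reduce to the rules for real limits. *)
Definition Cconv (s : nat -> C) (l : C) : Prop :=
  is_lim_seq (fun n => Cmod (s n - l)) 0.

Lemma Cmod_le_Re_Im (z : C) : Cmod z <= Rabs (Re z) + Rabs (Im z).
Proof.
  replace z with (RtoC (Re z) + RtoC (Im z) * Ci)%C at 1
    by (destruct z; unfold Ci, RtoC, Cmult, Cplus; simpl; f_equal; ring).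
  eapply Rle_trans; [apply Cmod_triangle|].
  rewrite Cmod_mult, Cmod_Ci, !Cmod_R; lra.
Qed.

Lemma im_le_Cmod (z : C) : Rabs (Im z) <= Cmod z.
Proof. eapply Rle_trans; [apply Rmax_r|apply Rmax_Cmod]. Qed.

Lemma Csum_ext (a b : nat -> C) : (forall k, a k = b k) -> Csum a = Csum b.
Proof.
  intros H; unfold Csum; f_equal; apply Series_ext; intros; rewrite H; auto.
Qed.

Lemma Cconv_ext (s t : nat -> C) (l : C) :
  (forall n, s n = t n) -> Cconv s l -> Cconv t l.
Proof. intros H; apply is_lim_seq_ext; intros; rewrite H; auto. Qed.

Lemma Cconv_squeeze (s : nat -> C) (l : C) (e : nat -> R) :
  (forall n, Cmod (s n - l) <= e n) -> is_lim_seq e 0 -> Cconv s l.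
Proof.
  intros H He; apply is_lim_seq_le_le with (u := fun _ => 0) (w := e); auto.
  - intros n; split; [apply Cmod_ge_0|auto].
  - apply is_lim_seq_const.
Qed.

Lemma Cconv_const (l : C) : Cconv (fun _ => l) l.
Proof.
  unfold Cconv; apply is_lim_seq_ext with (fun _ => 0); [|apply is_lim_seq_const].
  intros _; replace (l - l)%C with (RtoC 0) by ring; rewrite Cmod_0; auto.
Qed.

Lemma Cconv_plus (s t : nat -> C) (l m : C) :
  Cconv s l -> Cconv t m -> Cconv (fun n => (s n + t n)%C) (l + m)%C.
Proof.
  intros Hs Ht.
  apply Cconv_squeeze with (fun n => Cmod (s n - l) + Cmod (t n - m)).
  - intros n; replace (s n + t n - (l + m))%C with ((s n - l) + (t n - m))%C by ring.
    apply Cmod_triangle.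
  - replace 0 with (0 + 0) by ring; apply is_lim_seq_plus'; auto.
Qed.

Lemma Cconv_scal (c : C) (s : nat -> C) (l : C) :
  Cconv s l -> Cconv (fun n => (c * s n)%C) (c * l)%C.
Proof.
  intros Hs; apply Cconv_squeeze with (fun n => Cmod c * Cmod (s n - l)).
  - intros n; replace (c * s n - c * l)%C with (c * (s n - l))%C by ring.
    rewrite Cmod_mult; lra.
  - replace 0 with (Cmod c * 0) by ring.
    apply is_lim_seq_mult'; [apply is_lim_seq_const|auto].
Qed.

Lemma Cconv_mult (s t : nat -> C) (l m : C) (B : R) :
  (forall n, Cmod (s n) <= B) -> Cconv s l -> Cconv t m ->
  Cconv (fun n => (s n * t n)%C) (l * m)%C.
Proof.
  intros HB Hs Ht.
  apply Cconv_squeeze with (fun n => B * Cmod (t n - m) + Cmod m * Cmod (s n - l)).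
  - intros n.
    replace (s n * t n - l * m)%C with (s n * (t n - m) + m * (s n - l))%C by ring.
    eapply Rle_trans; [apply Cmod_triangle|]; rewrite !Cmod_mult.
    apply Rplus_le_compat_r, Rmult_le_compat_r; [apply Cmod_ge_0|apply HB].
  - replace 0 with (B * 0 + Cmod m * 0) by ring.
    apply is_lim_seq_plus'; apply is_lim_seq_mult'; auto; apply is_lim_seq_const.
Qed.

Lemma Cconv_unique (s : nat -> C) (l m : C) : Cconv s l -> Cconv s m -> l = m.
Proof.
  intros Hl Hm.
  enough (H : Cmod (l - m) <= 0).
  { assert (E : (l - m)%C = 0)
      by (apply Cmod_eq_0; pose proof (Cmod_ge_0 (l - m)); lra).
    replace l with (l - m + m)%C by ring; rewrite E; ring. }
  apply (is_lim_seq_le (fun _ => Cmod (l - m))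
    (fun n => Cmod (s n - l) + Cmod (s n - m)) (Cmod (l - m)) 0).
  - intros n; replace (l - m)%C with (- (s n - l) + (s n - m))%C by ring.
    eapply Rle_trans; [apply Cmod_triangle|rewrite Cmod_opp; lra].
  - apply is_lim_seq_const.
  - replace 0 with (0 + 0) by ring; apply is_lim_seq_plus'; auto.
Qed.

Lemma Cconv_Cmod_le (s : nat -> C) (l : C) (B : R) :
  Cconv s l -> (forall n, Cmod (s n) <= B) -> Cmod l <= B.
Proof.
  intros Hl HB.
  apply (is_lim_seq_le (fun _ => Cmod l) (fun n => B + Cmod (s n - l)) (Cmod l) B).
  - intros n; replace l with (s n + - (s n - l))%C at 1 by ring.
    eapply Rle_trans; [apply Cmod_triangle|rewrite Cmod_opp; specialize (HB n); lra].
  - apply is_lim_seq_const.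
  - replace B with (B + 0) at 1 by ring.
    apply is_lim_seq_plus'; [apply is_lim_seq_const|auto].
Qed.

Lemma csum_parts (a : nat -> C) (n : nat) :
  csum a n = (rsum (fun k => Re (a k)) n, rsum (fun k => Im (a k)) n).
Proof. induction n as [|n IH]; simpl; [|rewrite IH]; reflexivity. Qed.

Lemma absum_ex_parts (a : nat -> C) (B : R) : absum a B ->
  ex_series (fun k => Re (a k)) /\ ex_series (fun k => Im (a k)).
Proof.
  intros H; apply bnd_ex_series in H; [|intros; apply Cmod_ge_0].
  split; apply (@ex_series_le R_AbsRing R_CompleteNormedModule) with (2 := H); intros n.
  - apply re_le_Cmod.
  - apply im_le_Cmod.
Qed.

Lemma Csum_conv (a : nat -> C) (B : R) : absum a B -> Cconv (csum a) (Csum a).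
Proof.
  intros H; destruct (absum_ex_parts a B H) as [H1 H2].
  apply is_lim_seq_rsum in H1, H2.
  apply Cconv_squeeze with (fun n =>
    Rabs (rsum (fun k => Re (a k)) n - Series (fun k => Re (a k))) +
    Rabs (rsum (fun k => Im (a k)) n - Series (fun k => Im (a k)))).
  - intros n; rewrite csum_parts; apply Cmod_le_Re_Im.
  - replace 0 with (0 + 0) by ring.
    assert (E : forall x l, is_lim_seq x (Finite l) ->
      is_lim_seq (fun n => Rabs (x n - l)) 0).
    { intros x l Hx; apply (proj1 (is_lim_seq_abs_0 _)).
      rewrite <- (Rminus_diag l).
      apply is_lim_seq_minus'; [auto|apply is_lim_seq_const]. }
    apply is_lim_seq_plus'; apply E; auto.
Qed.

Lemma Csum_unique (a : nat -> C) (B : R) (s : C) :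
  absum a B -> Cconv (csum a) s -> Csum a = s.
Proof. intros H; apply Cconv_unique, Csum_conv with (1 := H). Qed.

Lemma Cmod_Csum (a : nat -> C) (B : R) : absum a B -> Cmod (Csum a) <= B.
Proof.
  intros H; apply Cconv_Cmod_le with (1 := Csum_conv a B H).
  intros n; eapply Rle_trans; [apply Cmod_csum|apply H].
Qed.

Lemma absum_dom (a : nat -> C) (b : nat -> R) (B : R) :
  bnd b B -> (forall k, Cmod (a k) <= b k) -> absum a B.
Proof. apply bnd_dom. Qed.

Lemma absum_plus (a b : nat -> C) (A B : R) : absum a A -> absum b B ->
  absum (fun k => (a k + b k)%C) (A + B).
Proof.
  intros Ha Hb n.
  eapply Rle_trans; [apply rsum_le; intros; apply Cmod_triangle|].
  rewrite rsum_plus; specialize (Ha n); specialize (Hb n); lra.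
Qed.

Lemma absum_scal (c : C) (a : nat -> C) (B : R) : absum a B ->
  absum (fun k => (c * a k)%C) (Cmod c * B).
Proof.
  intros H n; rewrite (rsum_ext _ (fun k => Cmod c * Cmod (a k)))
    by (intros; apply Cmod_mult).
  apply bnd_scal; [apply Cmod_ge_0|auto].
Qed.

Lemma absum_scal_bounded (c a : nat -> C) (b B : R) :
  (forall k, Cmod (c k) <= b) -> absum a B ->
  absum (fun k => (a k * c k)%C) (b * B).
Proof.
  intros Hc H n.
  apply Rle_trans with (rsum (fun k => b * Cmod (a k)) n).
  - apply rsum_le; intros k _; rewrite Cmod_mult, Rmult_comm.
    apply Rmult_le_compat_r; [apply Cmod_ge_0|auto].
  - rewrite rsum_scal; apply Rmult_le_compat_l; [|apply H].
    eapply Rle_trans; [apply Cmod_ge_0|apply (Hc O)].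
Qed.

Lemma Csum_plus (a b : nat -> C) (A B : R) : absum a A -> absum b B ->
  Csum (fun k => (a k + b k)%C) = (Csum a + Csum b)%C.
Proof.
  intros Ha Hb; eapply Csum_unique; [apply absum_plus; eauto|].
  apply Cconv_ext with (fun n => (csum a n + csum b n)%C).
  - intros; symmetry; apply csum_plus.
  - apply Cconv_plus; eapply Csum_conv; eauto.
Qed.

Lemma Csum_scal (c : C) (a : nat -> C) (B : R) : absum a B ->
  Csum (fun k => (c * a k)%C) = (c * Csum a)%C.
Proof.
  intros Ha; eapply Csum_unique; [apply absum_scal; eauto|].
  apply Cconv_ext with (fun n => (c * csum a n)%C).
  - intros; symmetry; apply csum_scal.
  - apply Cconv_scal; eapply Csum_conv; eauto.
Qed.

Lemma Csum_opp (a : nat -> C) (B : R) : absum a B ->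
  Csum (fun k => (- a k)%C) = (- Csum a)%C.
Proof.
  intros Ha; rewrite (Csum_ext _ (fun k => (- (1) * a k)%C)) by (intros; ring).
  rewrite (Csum_scal _ _ _ Ha); ring.
Qed.

Lemma absum_finite (a : nat -> C) (N : nat) :
  (forall k, (N <= k)%nat -> a k = 0) -> absum a (rsum (fun k => Cmod (a k)) N).
Proof.
  intros H n; destruct (le_lt_dec n N) as [Hn|Hn].
  - apply rsum_mono; auto; intros; apply Cmod_ge_0.
  - apply Nat.lt_le_incl in Hn; induction Hn as [|n Hn IH]; [lra|].
    simpl; rewrite (H n Hn), Cmod_0; lra.
Qed.

Lemma Csum_finite (a : nat -> C) (N : nat) :
  (forall k, (N <= k)%nat -> a k = 0) -> Csum a = csum a N.
Proof.
  intros H; eapply Csum_unique; [apply absum_finite; eauto|].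
  apply Cconv_squeeze with (fun n => if lt_dec n N then Cmod (csum a n - csum a N) else 0).
  - intros n; destruct (lt_dec n N) as [Hn|Hn]; [lra|].
    enough (E : csum a n = csum a N)
      by (rewrite E; replace (_ - _)%C with (RtoC 0) by ring; rewrite Cmod_0; lra).
    assert (Hn' : (N <= n)%nat) by lia; clear Hn.
    induction Hn' as [|n Hn IH]; auto; simpl; rewrite IH, H by auto; ring.
  - apply is_lim_seq_spec; intros eps; exists N; intros n Hn.
    destruct (lt_dec n N); [lia|].
    rewrite Rminus_0_r, Rabs_R0; apply cond_pos.
Qed.

Lemma Csum_0 : Csum (fun _ => RtoC 0) = 0.
Proof. rewrite (Csum_finite _ O); auto. Qed.

Lemma absum_shift (a : nat -> C) (B : R) : absum a B ->
  absum (fun k => a (S k)) B.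
Proof.
  intros H n; eapply Rle_trans; [|apply (H (S n))]; rewrite rsum_shift.
  pose proof (Cmod_ge_0 (a O)); lra.
Qed.

Lemma Csum_shift (a : nat -> C) (B : R) : absum a B ->
  Csum a = (a O + Csum (fun k => a (S k)))%C.
Proof.
  intros H.
  assert (H' := absum_shift a B H).
  symmetry; apply (Cconv_unique (fun n => csum a (S n))).
  - apply Cconv_ext with (fun n => (a O + csum (fun k => a (S k)) n)%C).
    + intros; symmetry; apply csum_shift.
    + apply Cconv_plus; [apply Cconv_const|eapply Csum_conv; eauto].
  - exact (proj1 (is_lim_seq_incr_1 (fun n => Cmod (csum a n - Csum a)) 0)
      (Csum_conv a B H)).
Qed.

Lemma csum_Csum (a : nat -> nat -> C) (b : nat -> R) (n : nat) :
  (forall i, (i < n)%nat -> absum (a i) (b i)) ->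
  csum (fun i => Csum (a i)) n = Csum (fun m => csum (fun i => a i m) n) /\
  absum (fun m => csum (fun i => a i m) n) (rsum b n).
Proof.
  induction n as [|n IH]; intros H; simpl.
  - rewrite Csum_0; split; auto.
    intros k; rewrite (rsum_ext _ (fun _ => 0 * 0)), rsum_scal; [lra|].
    intros; rewrite Cmod_0; ring.
  - destruct IH as [IH1 IH2]; [auto|]; split.
    + rewrite (Csum_plus _ _ _ _ IH2 (H n (Nat.lt_succ_diag_r n))), IH1; auto.
    + apply absum_plus; auto.
Qed.

(* Tannery's theorem. *)
Lemma Csum_dominated (g : nat -> nat -> C) (h : nat -> C) (b : nat -> R) (B : R) :
  bnd b B -> (forall n k, Cmod (g n k) <= b k) ->
  (forall k, Cconv (fun n => g n k) (h k)) ->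
  Cconv (fun n => Csum (g n)) (Csum h).
Proof.
  intros Hb Hg Hlim.
  assert (Hh : forall k, Cmod (h k) <= b k)
    by (intros k; apply Cconv_Cmod_le with (1 := Hlim k); auto).
  assert (Hd : forall n k, Cmod (g n k - h k) <= 2 * b k).
  { intros n k; eapply Rle_trans; [apply Cmod_triangle|rewrite Cmod_opp].
    specialize (Hg n k); specialize (Hh k); lra. }
  assert (H2 := bnd_scal b 2 B ltac:(lra) Hb).
  apply Cconv_squeeze with (fun n => Series (fun k => Cmod (g n k - h k))).
  - intros n.
    replace (Csum (g n) - Csum h)%C with (Csum (fun k => g n k + - (1) * h k)%C).
    + rewrite (Csum_ext _ (fun k => (g n k - h k)%C)) by (intros; ring).
      apply Cmod_Csum; intros m.
      apply rsum_le_Series; [intros; apply Cmod_ge_0|].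
      apply bnd_ex_series with (2 * B); [intros; apply Cmod_ge_0|].
      apply bnd_dom with (1 := H2); apply Hd.
    + erewrite Csum_plus, Csum_scal; [ring|..].
      * apply absum_dom with (1 := Hb); auto.
      * apply absum_dom with (1 := Hb); auto.
      * apply absum_scal, absum_dom with (1 := Hb); auto.
  - apply Series_dominated_zero with (2 := H2); [|exact Hlim].
    intros n k; split; [apply Cmod_ge_0|apply Hd].
Qed.

(** For finitely many rows [m] the bound follows by exchanging two finite sums. The error made in
    replacing each of the first [n] column sums by a partial sum tends to 0. *)
Lemma absum_Csum (a : nat -> nat -> C) (b : nat -> R) (B : R) :
  (forall m, absum (a m) (b m)) -> bnd b B ->
  absum (fun i => Csum (fun m => a m i)) B.
Proof.
  intros Ha Hb n.
  assert (Hcol : forall i, absum (fun m => a m i) B).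
  { intros i; apply absum_dom with (1 := Hb); intros m.
    apply (bnd_term (fun k => Cmod (a m k))); [intros; apply Cmod_ge_0|apply Ha]. }
  apply (is_lim_seq_le
    (fun M => rsum (fun i => Cmod (Csum (fun m => a m i))) n -
              rsum (fun i => Cmod (csum (fun m => a m i) M - Csum (fun m => a m i))) n)
    (fun _ => B) (rsum (fun i => Cmod (Csum (fun m => a m i))) n) B).
  - intros M.
    apply Rle_trans with (rsum (fun i => Cmod (csum (fun m => a m i) M)) n).
    + enough (rsum (fun i => Cmod (Csum (fun m => a m i))) n <=
        rsum (fun i => Cmod (csum (fun m => a m i) M)) n +
        rsum (fun i => Cmod (csum (fun m => a m i) M - Csum (fun m => a m i))) n) by lra.
      rewrite <- rsum_plus; apply rsum_le; intros i _.
      replace (Csum (fun m => a m i)) with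
        (csum (fun m => a m i) M + - (csum (fun m => a m i) M - Csum (fun m => a m i)))%C
        at 1 by ring.
      eapply Rle_trans; [apply Cmod_triangle|rewrite Cmod_opp; lra].
    + eapply Rle_trans; [apply rsum_le; intros; apply Cmod_csum|].
      rewrite rsum_switch; eapply Rle_trans; [|apply (Hb M)].
      apply rsum_le; intros m _; apply Ha.
  - match goal with |- is_lim_seq _ (Finite ?x) =>
      replace x with (x - 0) at 1 by ring end.
    apply is_lim_seq_minus'; [apply is_lim_seq_const|].
    clear -Hcol; induction n as [|n IH]; simpl; [apply is_lim_seq_const|].
    replace 0 with (0 + 0) by ring; apply is_lim_seq_plus'; auto.
    apply (Csum_conv _ _ (Hcol n)).
  - apply is_lim_seq_const.
Qed.

Lemma absum_col (a : nat -> nat -> C) (b : nat -> R) (B : R) (i : nat) :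
  (forall m, absum (a m) (b m)) -> bnd b B -> absum (fun m => a m i) B.
Proof.
  intros Ha Hb; apply absum_dom with (1 := Hb); intros m.
  apply (bnd_term (fun k => Cmod (a m k))); [intros; apply Cmod_ge_0|apply Ha].
Qed.

(** A sum over finitely many columns commutes with the sum over rows; Tannery's theorem with
    majorant [b] then lets the number of columns grow. *)
Lemma Csum_fubini (a : nat -> nat -> C) (b : nat -> R) (B : R) :
  (forall m, absum (a m) (b m)) -> bnd b B ->
  Csum (fun i => Csum (fun m => a m i)) = Csum (fun m => Csum (a m)).
Proof.
  intros Ha Hb; apply (Csum_unique _ B); [apply absum_Csum with b; auto|].
  apply Cconv_ext with (fun n => Csum (fun m => csum (a m) n)).
  - intros n; symmetry.
    apply (fun H => proj1 (csum_Csum (fun i m => a m i) (fun _ => B) n H)).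
    intros i _; exact (absum_col a b B i Ha Hb).
  - apply Csum_dominated with (1 := Hb).
    + intros n k; eapply Rle_trans; [apply Cmod_csum|apply Ha].
    + intros k; apply (Csum_conv _ _ (Ha k)).
Qed.

(** * Functions with an absolutely convergent Taylor series on a closed disc *)

(* [B] bounds the Wiener norm, for which these functions form a Banach algebra. *)
Definition ana (z0 : C) (rho : R) (F : C -> C) (B : R) : Prop :=
  exists a : nat -> C,
    bnd (fun i => Cmod (a i) * rho ^ i) B /\
    forall h : C, Cmod h <= rho -> F (z0 + h)%C = Csum (fun i => (a i * h ^ i)%C).

Lemma absum_power (a : nat -> C) (rho B : R) (h : C) :
  bnd (fun i => Cmod (a i) * rho ^ i) B -> Cmod h <= rho ->
  absum (fun i => (a i * h ^ i)%C) B.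
Proof.
  intros H Hh; apply absum_dom with (1 := H); intros i.
  rewrite Cmod_mult, Cmod_pow.
  apply Rmult_le_compat_l; [apply Cmod_ge_0|].
  apply pow_incr; split; [apply Cmod_ge_0|auto].
Qed.

Section Ana.
Variables (z0 : C) (rho : R).
Hypothesis rho_pos : 0 <= rho.

Lemma ana_pos (F : C -> C) (B : R) : ana z0 rho F B -> 0 <= B.
Proof. intros (a & Ha & _); apply bnd_pos with (1 := Ha). Qed.

Lemma ana_le (F : C -> C) (B B' : R) : ana z0 rho F B -> B <= B' -> ana z0 rho F B'.
Proof. intros (a & Ha & H) HB; exists a; split; auto; apply bnd_le with B; auto. Qed.

Lemma ana_ext (F G : C -> C) (B : R) :
  (forall h, Cmod h <= rho -> F (z0 + h)%C = G (z0 + h)%C) ->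
  ana z0 rho F B -> ana z0 rho G B.
Proof.
  intros E (a & Ha & H); exists a; split; auto.
  intros h Hh; rewrite <- E; auto.
Qed.

Lemma ana_bound (F : C -> C) (B : R) (h : C) : ana z0 rho F B -> Cmod h <= rho ->
  Cmod (F (z0 + h)%C) <= B.
Proof.
  intros (a & Ha & H) Hh; rewrite H by auto.
  apply Cmod_Csum, absum_power with rho; auto.
Qed.

Lemma ana_const (c : C) : ana z0 rho (fun _ => c) (Cmod c).
Proof.
  exists (fun i => match i with O => c | _ => RtoC 0 end); split.
  - intros [|n]; [apply Cmod_ge_0|].
    enough (rsum (fun i => Cmod match i with O => c | _ => RtoC 0 end * rho ^ i) (S n)
      = Cmod c) by lra.
    rewrite rsum_shift, (rsum_ext _ (fun _ => 0 * 0)), rsum_scal; [simpl; ring|].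
    intros; rewrite Cmod_0; ring.
  - intros h _; rewrite (Csum_finite _ 1); [simpl; ring|].
    intros [|k] Hk; [lia|ring].
Qed.

(** The coefficients move up by one place, which costs one factor [rho] in the norm. *)
Lemma ana_shift (F : C -> C) (B : R) : ana z0 rho F B ->
  ana z0 rho (fun z => ((z - z0) * F z)%C) (rho * B).
Proof.
  intros (a & Ha & H).
  set (a' i := match i with O => RtoC 0 | S i => a i end).
  assert (Hb : bnd (fun i => Cmod (a' i) * rho ^ i) (rho * B)).
  { intros [|n].
    - pose proof (bnd_pos _ _ Ha); simpl; apply Rmult_le_pos; auto.
    - rewrite rsum_shift; simpl; rewrite Cmod_0, (rsum_ext _ (fun i => rho * (Cmod (a i) * rho ^ i)))
        by (intros; ring).
      rewrite rsum_scal, Rmult_0_l, Rplus_0_l; apply Rmult_le_compat_l; auto. }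
  exists a'; split; auto.
  intros h Hh; rewrite H by auto.
  rewrite (Csum_shift (fun i => (a' i * h ^ i)%C) _ (absum_power _ _ _ _ Hb Hh)); simpl.
  rewrite (Csum_ext (fun k => (a k * (h * h ^ k))%C) (fun k => (h * (a k * h ^ k))%C))
    by (intros; ring).
  rewrite (Csum_scal h _ B) by (apply absum_power with rho; auto); ring.
Qed.

(** By Fubini the coefficients of the sum are the sums of the coefficients. Products, Neumann series
    and the kernel below all become analytic through this lemma. *)
Lemma ana_sum (F : nat -> C -> C) (b : nat -> R) (B : R) :
  (forall m, ana z0 rho (F m) (b m)) -> bnd b B ->
  ana z0 rho (fun z => Csum (fun m => F m z)) B.
Proof.
  intros HF Hb.
  set (a m := proj1_sig (constructive_indefinite_description _ (HF m))).
  assert (Ha : forall m, bnd (fun i => Cmod (a m i) * rho ^ i) (b m) /\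
    forall h, Cmod h <= rho -> F m (z0 + h)%C = Csum (fun i => (a m i * h ^ i)%C))
    by (intros m; exact (proj2_sig (constructive_indefinite_description _ (HF m)))).
  clearbody a.
  assert (Habs : forall h, Cmod h <= rho ->
    forall m, absum (fun i => (a m i * h ^ i)%C) (b m))
    by (intros h Hh m; apply absum_power with rho; auto; apply Ha).
  assert (Habs' : forall m, absum (fun i => (a m i * RtoC rho ^ i)%C) (b m))
    by (apply Habs; rewrite Cmod_R, Rabs_pos_eq; lra).
  (* At radius 0 the norm controls only the constant coefficient, so the sums of the higher
     coefficients may diverge; a constant function serves there instead. *)
  destruct (Req_dec rho 0) as [Hrho|Hrho].
  { apply ana_ext with (fun _ => Csum (fun m => F m z0)).
    - intros h Hh; replace h with (RtoC 0); [apply Csum_ext; intros; f_equal; ring|].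
      symmetry; apply Cmod_eq_0; pose proof (Cmod_ge_0 h); lra.
    - apply ana_le with (1 := ana_const _), Cmod_Csum.
      apply absum_dom with (1 := Hb); intros m.
      replace z0 with (z0 + 0)%C by ring; apply ana_bound; auto; rewrite Cmod_0; lra. }
  assert (Hcol : forall i, absum (fun m => a m i) (B / rho ^ i)).
  { intros i.
    apply absum_dom with (fun m => / rho ^ i * b m).
    - unfold Rdiv; rewrite Rmult_comm; apply bnd_scal; auto.
      apply Rlt_le, Rinv_0_lt_compat, pow_lt; lra.
    - intros m; apply Rmult_le_reg_l with (rho ^ i); [apply pow_lt; lra|].
      rewrite <- Rmult_assoc, Rinv_r, Rmult_1_l by (apply pow_nonzero; auto).
      rewrite Rmult_comm; apply (bnd_term (fun i => Cmod (a m i) * rho ^ i)); [|apply Ha].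
      intros; apply Rmult_le_pos; [apply Cmod_ge_0|apply pow_le; auto]. }
  assert (Hfac : forall i h, Csum (fun m => (a m i * h ^ i)%C) = (Csum (fun m => a m i) * h ^ i)%C).
  { intros i h; rewrite (Csum_ext _ (fun m => (h ^ i * a m i)%C)) by (intros; ring).
    rewrite (Csum_scal _ _ _ (Hcol i)); ring. }
  exists (fun i => Csum (fun m => a m i)); split.
  - intros n; eapply Rle_trans; [|exact (absum_Csum _ _ _ Habs' Hb n)].
    apply Req_le, rsum_ext; intros i _.
    rewrite Hfac, Cmod_mult, Cmod_pow, Cmod_R, Rabs_pos_eq by auto; reflexivity.
  - intros h Hh.
    rewrite (Csum_ext _ _ (fun i => eq_sym (Hfac i h))).
    rewrite (Csum_fubini _ _ _ (Habs h Hh) Hb).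
    apply Csum_ext; intros m; apply Ha; auto.
Qed.

Lemma ana_scal (c : C) (F : C -> C) (B : R) : ana z0 rho F B ->
  ana z0 rho (fun z => (c * F z)%C) (Cmod c * B).
Proof.
  intros (a & Ha & H); exists (fun i => (c * a i)%C); split.
  - intros n; rewrite (rsum_ext _ (fun i => Cmod c * (Cmod (a i) * rho ^ i)))
      by (intros; rewrite Cmod_mult; ring).
    apply bnd_scal; auto; apply Cmod_ge_0.
  - intros h Hh; rewrite H, <- (Csum_scal c _ B) by (auto; apply absum_power with rho; auto).
    apply Csum_ext; intros; ring.
Qed.

Lemma ana_plus (F G : C -> C) (A B : R) : ana z0 rho F A -> ana z0 rho G B ->
  ana z0 rho (fun z => (F z + G z)%C) (A + B).
Proof.
  intros (a & Ha & HF) (b & Hb & HG); exists (fun i => (a i + b i)%C); split.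
  - intros n; eapply Rle_trans; [|exact (Rplus_le_compat _ _ _ _ (Ha n) (Hb n))].
    rewrite <- rsum_plus; apply rsum_le; intros i _.
    rewrite <- Rmult_plus_distr_r; apply Rmult_le_compat_r;
      [apply pow_le; auto|apply Cmod_triangle].
  - intros h Hh; rewrite HF, HG by auto.
    rewrite <- (Csum_plus _ _ A B) by (apply absum_power with rho; auto).
    apply Csum_ext; intros; ring.
Qed.

Lemma ana_opp (F : C -> C) (B : R) : ana z0 rho F B ->
  ana z0 rho (fun z => (- F z)%C) B.
Proof.
  intros H; apply (ana_ext (fun z => (- (1) * F z)%C)); [intros; ring|].
  replace B with (Cmod (- (1)) * B); [apply ana_scal; auto|].
  rewrite Cmod_opp, Cmod_1; ring.
Qed.

Lemma ana_shift_pow (F : C -> C) (B : R) (i : nat) : ana z0 rho F B ->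
  ana z0 rho (fun z => ((z - z0) ^ i * F z)%C) (rho ^ i * B).
Proof.
  intros H; induction i as [|i IH].
  - apply (ana_ext F); [intros; simpl; ring|]; rewrite Rmult_1_l; auto.
  - apply (ana_ext (fun z => ((z - z0) * ((z - z0) ^ i * F z))%C)); [intros; simpl; ring|].
    simpl; rewrite Rmult_assoc; apply ana_shift; auto.
Qed.

(** Expanding only [F] writes the product as the sum of a_i (z - z0)^i G(z), so that shifts of [G]
    take the place of a Cauchy product. *)
Lemma ana_mult (F G : C -> C) (A B : R) : ana z0 rho F A -> ana z0 rho G B ->
  ana z0 rho (fun z => (F z * G z)%C) (A * B).
Proof.
  intros (a & Ha & HF) HG.
  apply (ana_ext (fun z => Csum (fun i => (a i * ((z - z0) ^ i * G z))%C))).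
  - intros h Hh; rewrite HF by auto.
    rewrite (Csum_ext _ (fun i => (G (z0 + h) * (a i * h ^ i))%C)).
    + rewrite (Csum_scal _ _ A); [ring|apply absum_power with rho; auto].
    + intros i; replace (z0 + h - z0)%C with h by ring; ring.
  - apply (ana_sum _ (fun i => B * (Cmod (a i) * rho ^ i))).
    + intros i; replace (B * _) with (Cmod (a i) * (rho ^ i * B)) by ring.
      apply ana_scal, ana_shift_pow; auto.
    + rewrite Rmult_comm; apply bnd_scal; auto; apply ana_pos with (1 := HG).
Qed.

Lemma ana_id : ana z0 rho (fun z => z) (Cmod z0 + rho).
Proof.
  apply (ana_ext (fun z => (z0 + (z - z0) * 1)%C)); [intros; ring|].
  apply ana_plus; [apply ana_const|].
  replace rho with (rho * Cmod 1) at 2 by (rewrite Cmod_1; ring).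
  apply (ana_shift (fun _ => RtoC 1)), ana_const.
Qed.

Lemma ana_pow (n : nat) : ana z0 rho (fun z => (z ^ n)%C) ((Cmod z0 + rho) ^ n).
Proof.
  induction n as [|n IH]; simpl.
  - apply ana_le with (1 := ana_const 1); rewrite Cmod_1; lra.
  - apply ana_mult; [apply ana_id|auto].
Qed.

Lemma ana_shrink (r : R) (F : C -> C) (B : R) : 0 <= r <= rho ->
  ana z0 rho F B -> ana z0 r F B.
Proof.
  intros Hr (a & Ha & H); exists a; split; [|intros; apply H; lra].
  apply bnd_dom with (1 := Ha); intros i.
  apply Rmult_le_compat_l; [apply Cmod_ge_0|apply pow_incr; lra].
Qed.

(** Without the constant term, each remaining term gains at least one factor r/rho on the smaller
    disc. This is the source of smallness near [z0] and of continuity. *)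
Lemma ana_increment (r : R) (F : C -> C) (B : R) : 0 <= r <= rho -> 0 < rho ->
  ana z0 rho F B -> ana z0 r (fun z => (F z - F z0)%C) (r / rho * B).
Proof.
  intros Hr Hrho (a & Ha & H).
  set (a' i := match i with O => RtoC 0 | S i => a (S i) end).
  assert (Hb : bnd (fun i => Cmod (a' i) * r ^ i) (r / rho * B)).
  { intros n.
    apply Rle_trans with (r / rho * rsum (fun i => Cmod (a i) * rho ^ i) n).
    - rewrite <- rsum_scal; apply rsum_le; intros [|i] _; simpl.
      + rewrite Cmod_0, Rmult_0_l.
        apply Rmult_le_pos; [apply Rdiv_le_0_compat; lra|].
        apply Rmult_le_pos; [apply Cmod_ge_0|lra].
      + replace (r / rho * _) with (Cmod (a (S i)) * (r * rho ^ i)) by (field; lra).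
        apply Rmult_le_compat_l; [apply Cmod_ge_0|].
        apply Rmult_le_compat_l; [lra|apply pow_incr; lra].
    - apply Rmult_le_compat_l; [apply Rdiv_le_0_compat; lra|auto]. }
  exists a'; split; auto.
  intros h Hh.
  assert (Ha' := absum_power a rho B h Ha ltac:(lra)).
  assert (Hb' := absum_power a' r _ h Hb Hh).
  replace (F z0) with (a O).
  - rewrite H by lra; rewrite (Csum_shift _ _ Ha'), (Csum_shift _ _ Hb'); simpl; ring.
  - replace z0 with (z0 + 0)%C by ring; rewrite H by (rewrite Cmod_0; lra).
    rewrite (Csum_finite _ 1); [simpl; ring|].
    intros [|k] Hk; [lia|simpl; ring].
Qed.

(** * Neumann series *)

(** The term (-E)^n g of the series for the inverse of I + E applied to g. *)
Fixpoint neumann_term (E : nat -> nat -> C -> C) (g : nat -> C -> C) (n l : nat) (z : C) : C :=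
  match n with
  | O => g l z
  | S n => (- Csum (fun m => (E l m z * neumann_term E g n m z)%C))%C
  end.

Definition neumann (E : nat -> nat -> C -> C) (g : nat -> C -> C) (l : nat) (z : C) : C :=
  Csum (fun n => neumann_term E g n l z).

Section Neumann.
Variables (E : nat -> nat -> C -> C) (e : nat -> nat -> R).
Hypothesis HE : forall l m, ana z0 rho (E l m) (e l m).
Hypothesis He : forall l, bnd (e l) (/ 2).
Variables (g : nat -> C -> C) (beta : R).
Hypothesis Hg : forall l, ana z0 rho (g l) beta.

Let beta_pos : 0 <= beta := ana_pos _ _ (Hg O).

(** Every row of [E] has total norm at most 1/2, so one application of [E] halves a bound that is
    uniform in the coordinate. *)
Lemma ana_neumann_term (n l : nat) :
  ana z0 rho (neumann_term E g n l) (beta * (/ 2) ^ n).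
Proof.
  revert l; induction n as [|n IH]; intros l; simpl.
  - rewrite Rmult_1_r; apply Hg.
  - apply ana_opp.
    replace (beta * _) with (beta * (/ 2) ^ n * / 2) by ring.
    apply (ana_sum _ (fun m => beta * (/ 2) ^ n * e l m)).
    + intros m; rewrite Rmult_comm; apply ana_mult; auto.
    + apply bnd_scal; [apply ana_pos with (1 := IH O)|auto].
Qed.

Let Hgeom : bnd (fun n => beta * (/ 2) ^ n) (2 * beta).
Proof. rewrite Rmult_comm; apply bnd_scal; [exact beta_pos|apply bnd_geom]. Qed.

Lemma ana_neumann (l : nat) : ana z0 rho (neumann E g l) (2 * beta).
Proof. apply ana_sum with (2 := Hgeom); intros; apply ana_neumann_term. Qed.

(** After exchanging the sums over [m] and [n], [E] sends each term to minus the next one, so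
    everything cancels except the term of index 0. *)
Lemma neumann_eq (l : nat) (h : C) : Cmod h <= rho ->
  (neumann E g l (z0 + h) + Csum (fun m => E l m (z0 + h)%C * neumann E g m (z0 + h)%C) =
   g l (z0 + h))%C.
Proof.
  intros Hh; set (z := (z0 + h)%C).
  assert (HX : forall n m, Cmod (neumann_term E g n m z) <= beta * (/ 2) ^ n)
    by (intros n m; apply ana_bound; auto; apply ana_neumann_term).
  assert (Hs : forall m, absum (fun n => neumann_term E g n m z) (2 * beta))
    by (intros m; apply absum_dom with (1 := Hgeom); auto).
  assert (HEm : forall m, Cmod (E l m z) <= e l m)
    by (intros m; apply ana_bound; auto).
  assert (Hrow : forall m, absum (fun n => (E l m z * neumann_term E g n m z)%C) (2 * beta * e l m)).
  { intros m n; eapply Rle_trans; [apply (absum_scal (E l m z) _ _ (Hs m) n)|].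
    rewrite Rmult_comm; apply Rmult_le_compat_l; [pose proof beta_pos; lra|auto]. }
  assert (Hb : bnd (fun m => 2 * beta * e l m) (2 * beta * / 2))
    by (apply bnd_scal; [pose proof beta_pos; lra|auto]).
  rewrite (Csum_ext _ (fun m => Csum (fun n => (E l m z * neumann_term E g n m z)%C)))
    by (intros m; symmetry; apply Csum_scal with (1 := Hs m)).
  rewrite <- (Csum_fubini _ _ _ Hrow Hb).
  unfold neumann; rewrite (Csum_shift _ _ (Hs l)); simpl.
  rewrite (Csum_opp _ _ (absum_Csum _ _ _ Hrow Hb)); ring.
Qed.

End Neumann.
End Ana.

(** The equation turns any uniform bound on [x] into half of it, and this is iterated. *)
Lemma neumann_unique (E : nat -> nat -> C) (x : nat -> C) (beta : R) :
  (forall l, absum (E l) (/ 2)) -> (forall l, Cmod (x l) <= beta) ->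
  (forall l, (x l + Csum (fun m => E l m * x m) = 0)%C) ->
  forall l, x l = 0.
Proof.
  intros HE Hx H.
  assert (Hn : forall n l, Cmod (x l) <= beta * (/ 2) ^ n).
  { induction n as [|n IH]; intros l; simpl; [rewrite Rmult_1_r; auto|].
    replace (x l) with (- Csum (fun m => E l m * x m))%C.
    - rewrite Cmod_opp.
      replace (beta * _) with (beta * (/ 2) ^ n * / 2) by ring.
      apply Cmod_Csum, absum_scal_bounded; auto.
    - replace (x l) with (x l + Csum (fun m => E l m * x m) - Csum (fun m => E l m * x m))%C by ring.
      rewrite H; ring. }
  intros l; apply Cmod_eq_0, Rle_antisym; [|apply Cmod_ge_0].
  apply (is_lim_seq_le (fun _ => Cmod (x l)) (fun n => beta * (/ 2) ^ n) (Cmod (x l)) 0).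
  - intros n; apply Hn.
  - apply is_lim_seq_const.
  - replace 0 with (beta * 0) by ring; apply is_lim_seq_mult'; [apply is_lim_seq_const|].
    apply is_lim_seq_geom; rewrite Rabs_pos_eq; lra.
Qed.

(** * Finite linear systems *)

Definition matvec (N : nat) (P : nat -> nat -> C) (x : nat -> C) (l : nat) : C :=
  csum (fun j => (P l j * x j)%C) N.

Lemma matvec_ext (N : nat) (P : nat -> nat -> C) (x y : nat -> C) (l : nat) :
  (forall j, (j < N)%nat -> x j = y j) -> matvec N P x l = matvec N P y l.
Proof. intros H; apply csum_ext; intros k Hk; rewrite H; auto. Qed.

Lemma matvec_plus (N : nat) (P : nat -> nat -> C) (x y : nat -> C) (l : nat) :
  matvec N P (fun j => (x j + y j)%C) l = (matvec N P x l + matvec N P y l)%C.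
Proof. unfold matvec; rewrite <- csum_plus; apply csum_ext; intros; ring. Qed.

Lemma matvec_opp (N : nat) (P : nat -> nat -> C) (x : nat -> C) (l : nat) :
  matvec N P (fun j => (- x j)%C) l = (- matvec N P x l)%C.
Proof.
  unfold matvec; rewrite (csum_ext _ (fun j => (- (1) * (P l j * x j))%C)) by (intros; ring).
  rewrite csum_scal; ring.
Qed.

Lemma matvec_matvec (N : nat) (P Q : nat -> nat -> C) (x : nat -> C) (l : nat) :
  matvec N P (matvec N Q x) l =
  matvec N (fun l j => csum (fun k => (P l k * Q k j)%C) N) x l.
Proof.
  unfold matvec.
  rewrite (csum_ext _ (fun k => csum (fun j => (P l k * (Q k j * x j))%C) N))
    by (intros; rewrite csum_scal; auto).
  rewrite csum_switch; apply csum_ext; intros j _.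
  rewrite (csum_ext _ (fun k => (x j * (P l k * Q k j))%C)) by (intros; ring).
  rewrite csum_scal; ring.
Qed.

(** Gaussian elimination by induction on the number of equations: there are [N] equations in the
    unknowns 0 to [N], and the last equation eliminates the last unknown. *)
Lemma underdetermined_kernel (N : nat) (P : nat -> nat -> C) :
  exists x : nat -> C, (exists j, (j <= N)%nat /\ x j <> 0) /\
    forall l, (l < N)%nat -> matvec (S N) P x l = 0.
Proof.
  revert P; induction N as [|N IH]; intros P.
  { exists (fun _ => RtoC 1); split; [|intros; lia].
    exists O; split; auto; intros H; injection H; lra. }
  (* With a nonzero pivot in the last row and column, multiples of the last row clear the last
     column elsewhere, and the last unknown is then read off from the last row. *)
  assert (Hpiv : forall P : nat -> nat -> C, P N (S N) <> 0 ->
    exists x : nat -> C, (exists j, (j <= S N)%nat /\ x j <> 0) /\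
      forall l, (l < S N)%nat -> matvec (S (S N)) P x l = 0).
  { clear P; intros P HP.
    destruct (IH (fun l j => (P l j - P l (S N) / P N (S N) * P N j)%C))
      as (x & (j & Hj & Hxj) & Hx).
    set (y j := if Nat.eq_dec j (S N) then (- (matvec (S N) P x N) / P N (S N))%C else x j).
    exists y; split.
    { exists j; split; [lia|]; unfold y; destruct Nat.eq_dec; [lia|auto]. }
    assert (Hy : forall l, matvec (S (S N)) P y l =
      (matvec (S N) P x l - P l (S N) / P N (S N) * matvec (S N) P x N)%C).
    { intros l.
      transitivity (matvec (S N) P y l + P l (S N) * y (S N))%C; [reflexivity|].
      rewrite (matvec_ext _ P y x).
      - unfold y; destruct Nat.eq_dec; [field; auto|lia].
      - intros k Hk; unfold y; destruct Nat.eq_dec; [lia|auto]. }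
    intros l Hl; rewrite Hy.
    destruct (Nat.eq_dec l N) as [->|Hl']; [field; auto|].
    rewrite <- (Hx l) by lia; unfold matvec.
    rewrite (csum_ext (fun j => ((P l j - _) * _)%C)
      (fun j => (P l j * x j + - (P l (S N) / P N (S N)) * (P N j * x j))%C)) by (intros; ring).
    rewrite csum_plus, csum_scal; ring. }
  destruct (classic (P N (S N) = 0)) as [HN|HN]; [|auto].
  destruct (classic (exists j0, (j0 < S N)%nat /\ P N j0 <> 0)) as [(j0 & Hj0 & Hp)|Hall].
  (* Adding column [j0] to the last column makes [P N j0] the pivot; in the solution this is undone
     by adding [x (S N)] to coordinate [j0]. *)
  - destruct (Hpiv (fun l j => if Nat.eq_dec j (S N) then P l (S N) + P l j0 else P l j)%C)
      as (x & (j & Hj & Hxj) & Hx).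
    { destruct Nat.eq_dec; [rewrite HN; intros H; apply Hp; rewrite <- H; ring|lia]. }
    set (y j := (x j + if Nat.eq_dec j j0 then x (S N) else 0)%C).
    exists y; split.
    + destruct (classic (x (S N) = 0)) as [E|E].
      * exists j; split; auto; unfold y; destruct Nat.eq_dec; rewrite ?E, Cplus_0_r; auto.
      * exists (S N); split; auto; unfold y; destruct Nat.eq_dec; [lia|].
        rewrite Cplus_0_r; auto.
    + intros l Hl; rewrite <- (Hx l) by lia.
      unfold y; rewrite matvec_plus.
      transitivity (matvec (S N) P x l + P l (S N) * x (S N) + P l j0 * x (S N))%C.
      * apply (f_equal (fun c => (matvec (S (S N)) P x l + c)%C)); unfold matvec.
        rewrite <- (csum_delta (fun j => P l j * x (S N))%C j0 (S (S N))) by lia.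
        apply csum_ext; intros k _; destruct Nat.eq_dec; ring.
      * set (P' l j := if Nat.eq_dec j (S N) then (P l (S N) + P l j0)%C else P l j).
        transitivity (matvec (S N) P' x l + P' l (S N) * x (S N))%C; [|reflexivity].
        replace (matvec (S N) P' x l) with (matvec (S N) P x l).
        -- unfold P'; destruct Nat.eq_dec; [ring|lia].
        -- apply csum_ext; intros k Hk; unfold P'; destruct Nat.eq_dec; [lia|auto].
  (* The last row vanishes, so the last unknown may be set to 0. *)
  - destruct (IH P) as (x & (j & Hj & Hxj) & Hx).
    set (y j := if Nat.eq_dec j (S N) then RtoC 0 else x j).
    exists y; split.
    { exists j; split; [lia|]; unfold y; destruct Nat.eq_dec; [lia|auto]. }
    intros l Hl.
    transitivity (matvec (S N) P y l + P l (S N) * y (S N))%C; [reflexivity|].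
    replace (y (S N)) with (RtoC 0) by (unfold y; destruct Nat.eq_dec; [auto|lia]).
    rewrite (matvec_ext _ P y x) by (intros k Hk; unfold y; destruct Nat.eq_dec; [lia|auto]).
    destruct (Nat.eq_dec l N) as [->|Hl'].
    + unfold matvec; rewrite csum_zero; [ring|].
      intros k Hk; destruct (classic (P N k = 0)) as [E|E]; [rewrite E; ring|].
      exfalso; eauto.
    + rewrite Hx by lia; ring.
Qed.

(** Appending the column [- g] gives more unknowns than equations. Injectivity forces the last
    coordinate of a kernel vector to be nonzero, and dividing by it solves P x = g. The solutions
    for the unit vectors are the columns of the inverse. *)
Lemma injective_matrix_inverse (N : nat) (P : nat -> nat -> C) :
  (forall x, (forall l, (l < N)%nat -> matvec N P x l = 0) ->
     forall l, (l < N)%nat -> x l = 0) ->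
  exists Q : nat -> nat -> C, forall x l, (l < N)%nat ->
    matvec N P (matvec N Q x) l = x l /\ matvec N Q (matvec N P x) l = x l.
Proof.
  intros Hinj.
  assert (Hsurj : forall g : nat -> C, exists x, forall l, (l < N)%nat -> matvec N P x l = g l).
  { intros g.
    destruct (underdetermined_kernel N
      (fun l j => if Nat.eq_dec j N then - g l else P l j)%C) as (x & (j & Hj & Hxj) & Hx).
    assert (Hx' : forall l, (l < N)%nat -> (matvec N P x l - g l * x N = 0)%C).
    { intros l Hl; rewrite <- (Hx l Hl); unfold matvec; simpl.
      destruct (Nat.eq_dec N N) as [_|]; [|lia].
      rewrite (csum_ext (fun j => (P l j * x j)%C)
        (fun j => ((if Nat.eq_dec j N then - g l else P l j) * x j)%C)); [ring|].
      intros k Hk; destruct Nat.eq_dec; [lia|auto]. }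
    assert (HN : x N <> 0).
    { intros E; destruct (Nat.eq_dec j N) as [->|Hn]; [auto|].
      apply Hxj, Hinj; [|lia].
      intros l Hl; rewrite <- (Hx' l Hl), E; ring. }
    exists (fun j => (/ x N * x j)%C); intros l Hl; unfold matvec.
    rewrite (csum_ext _ (fun j => (/ x N * (P l j * x j))%C)) by (intros; ring).
    rewrite csum_scal; fold (matvec N P x l).
    replace (matvec N P x l) with (g l * x N + (matvec N P x l - g l * x N))%C by ring.
    rewrite Hx' by auto; field; auto. }
  assert (HQ : forall k, exists x, forall l, (l < N)%nat ->
    matvec N P x l = if Nat.eq_dec k l then RtoC 1 else RtoC 0)
    by (intros k; apply Hsurj).
  set (Q j k := proj1_sig (constructive_indefinite_description _ (HQ k)) j).
  assert (HPQ : forall x l, (l < N)%nat -> matvec N P (matvec N Q x) l = x l).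
  { intros x l Hl; rewrite matvec_matvec; unfold matvec.
    rewrite <- (csum_delta x l N Hl); apply csum_ext; intros k Hk.
    replace (csum _ _) with (if Nat.eq_dec k l then RtoC 1 else RtoC 0).
    - destruct Nat.eq_dec; ring.
    - symmetry; exact (proj2_sig (constructive_indefinite_description _ (HQ k)) l Hl). }
  exists Q; intros x l Hl; split; [auto|].
  (* The right inverse is also a left inverse, because [P] annihilates Q P x - x. *)
  enough (E : forall l, (l < N)%nat ->
    (matvec N Q (matvec N P x) l + - x l = 0)%C).
  { replace (x l) with (x l + 0)%C by ring; rewrite <- (E l Hl); ring. }
  apply Hinj; clear l Hl; intros l Hl.
  rewrite matvec_plus, matvec_opp, HPQ by auto; ring.
Qed.

(** * An analytic Fredholm theorem for infinite matrices *)

Definition bounded_seq (x : nat -> C) : Prop := exists beta, forall l, Cmod (x l) <= beta.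

Definition injective_at (A : nat -> nat -> C -> C) (z : C) : Prop :=
  forall x : nat -> C, bounded_seq x ->
    (forall l, (x l + Csum (fun m => A l m z * x m) = 0)%C) -> forall l, x l = 0.

Section Fredholm.
Variables (A : nat -> nat -> C -> C) (b : nat -> R) (B : R) (z0 : C).
Hypothesis HA : forall l m, ana z0 1 (A l m) (b m).
Hypothesis Hb : bnd b B.
Variables (g : nat -> C -> C) (beta : R).
Hypothesis Hg : forall l, ana z0 1 (g l) beta.

Let b_pos (m : nat) : 0 <= b m := ana_pos _ _ _ _ (HA O m).
Let b_le (m : nat) : b m <= B := bnd_term _ _ _ b_pos Hb.
Let r01 : 0 <= 1 := Rle_0_1.

Variable N : nat.
Hypothesis HN : bnd (fun m => if lt_dec m N then 0 else b m) (/ 2).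

(** [A] without its first [N] columns: by [HN] its rows have norm at most 1/2. *)
Let E (l m : nat) (z : C) : C := if lt_dec m N then RtoC 0 else A l m z.

Let HE (l m : nat) : ana z0 1 (E l m) (if lt_dec m N then 0 else b m).
Proof.
  unfold E; destruct lt_dec; [|apply HA].
  apply ana_le with (1 := ana_const z0 1 0); rewrite Cmod_0; lra.
Qed.

(** The inverse of I + E applied to column [j] of [A]; only the erased columns j < N will occur. *)
Let s (j l : nat) (z : C) : C := neumann E (fun l => A l j) l z.

Let Hs (j l : nat) : ana z0 1 (s j l) (2 * B).
Proof.
  apply ana_le with (2 * b j); [|specialize (b_le j); lra].
  apply (ana_neumann z0 1 r01 E _ HE (fun _ => HN) (fun l => A l j)).
  intros; apply HA.
Qed.

Lemma E_absum (l : nat) (h : C) : Cmod h <= 1 -> absum (fun m => E l m (z0 + h)%C) (/ 2).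
Proof.
  intros Hh; apply absum_dom with (1 := HN); intros m.
  apply (ana_bound z0 1); auto.
Qed.

Lemma A_split (l : nat) (h : C) (x : nat -> C) : Cmod h <= 1 -> bounded_seq x ->
  Csum (fun m => A l m (z0 + h) * x m)%C =
  (Csum (fun m => E l m (z0 + h) * x m) + csum (fun m => A l m (z0 + h) * x m) N)%C.
Proof.
  intros Hh (X & HX).
  rewrite (Csum_ext _ (fun m => E l m (z0 + h) * x m +
    if lt_dec m N then A l m (z0 + h) * x m else 0)%C).
  - erewrite Csum_plus.
    + f_equal; rewrite (Csum_finite _ N).
      * apply csum_ext; intros k Hk; destruct lt_dec; [auto|lia].
      * intros k Hk; destruct lt_dec; [lia|auto].
    + apply absum_scal_bounded with (1 := HX), E_absum; auto.
    + apply absum_finite with (N := N).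
      intros k Hk; destruct lt_dec; [lia|auto].
  - intros m; unfold E; destruct lt_dec; ring.
Qed.

Lemma s_bound (j l : nat) (h : C) : Cmod h <= 1 -> Cmod (s j l (z0 + h)) <= 2 * B.
Proof. intros Hh; apply (ana_bound z0 1); auto. Qed.

Lemma s_sum_bounded (h : C) (x : nat -> C) : Cmod h <= 1 ->
  bounded_seq (fun l => csum (fun j => x j * s j l (z0 + h))%C N).
Proof.
  intros Hh; exists (rsum (fun j => Cmod (x j) * (2 * B)) N); intros l.
  eapply Rle_trans; [apply Cmod_csum|]; apply rsum_le; intros j _.
  rewrite Cmod_mult; apply Rmult_le_compat_l; [apply Cmod_ge_0|apply s_bound; auto].
Qed.

Lemma bounded_minus (x y : nat -> C) : bounded_seq x -> bounded_seq y ->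
  bounded_seq (fun l => (x l - y l)%C).
Proof.
  intros (X & HX) (Y & HY); exists (X + Y); intros l.
  eapply Rle_trans; [apply Cmod_triangle|rewrite Cmod_opp].
  specialize (HX l); specialize (HY l); lra.
Qed.

Lemma bounded_0 : bounded_seq (fun _ => RtoC 0).
Proof. exists 0; intros _; rewrite Cmod_0; lra. Qed.

(* The tail [E] of [A] is inverted by a Neumann series, which reduces the
   equation to one for the first [N] coordinates [x]. *)
Lemma tail_solution (h : C) (G gamma x : nat -> C) : Cmod h <= 1 -> bounded_seq G ->
  (forall l, (G l + Csum (fun m => E l m (z0 + h) * G m) = gamma l)%C) ->
  let a l := (G l - csum (fun j => x j * s j l (z0 + h)) N)%C in
  forall l, (a l + Csum (fun m => E l m (z0 + h) * a m) =
    gamma l - csum (fun j => x j * A l j (z0 + h)) N)%C.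
Proof.
  intros Hh HG HGe a l; destruct HG as [X HX].
  assert (H1 : forall j, (j < N)%nat ->
    absum (fun m => E l m (z0 + h) * (x j * s j m (z0 + h)))%C (Cmod (x j) * (2 * B) * / 2)).
  { intros j _; apply absum_scal_bounded; [|apply E_absum; auto].
    intros m; rewrite Cmod_mult; apply Rmult_le_compat_l; [apply Cmod_ge_0|apply s_bound; auto]. }
  destruct (csum_Csum _ _ _ H1) as [H2 H3].
  assert (H4 : Csum (fun m => E l m (z0 + h) * a m)%C =
    (Csum (fun m => E l m (z0 + h) * G m) -
     csum (fun j => x j * Csum (fun m => E l m (z0 + h) * s j m (z0 + h))) N)%C).
  { rewrite (Csum_ext _ (fun m => E l m (z0 + h) * G m +
      - (1) * csum (fun j => E l m (z0 + h) * (x j * s j m (z0 + h))) N)%C)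
      by (intros; unfold a; rewrite csum_scal; ring).
    erewrite Csum_plus, Csum_scal, <- H2.
    - rewrite (csum_ext _ (fun j => x j * Csum (fun m => E l m (z0 + h) * s j m (z0 + h)))%C).
      + ring.
      + intros j _.
        rewrite <- (Csum_scal (x j) _ (2 * B * / 2)).
        * apply Csum_ext; intros; ring.
        * apply absum_scal_bounded; [|apply E_absum; auto].
          intros m; apply s_bound; auto.
    - exact H3.
    - apply absum_scal_bounded with (1 := HX), E_absum; auto.
    - apply absum_scal; exact H3. }
  rewrite H4, <- HGe; unfold a.
  rewrite (csum_ext (fun j => x j * A l j (z0 + h))%C
    (fun j => x j * s j l (z0 + h) + x j * Csum (fun m => E l m (z0 + h) * s j m (z0 + h)))%C).
  - rewrite csum_plus; ring.
  - intros j _; rewrite <- Cmult_plus_distr_l; f_equal; symmetry.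
    apply (neumann_eq z0 1 r01 E _ HE (fun _ => HN) (fun l => A l j) (b j)); auto.
Qed.

(** The hypothesis on [x] says that a_l = x_l for l < N. So the sum subtracted in [tail_solution] is
    exactly the contribution of the first [N] columns to A a. *)
Lemma lifted_solution (h : C) (G gamma x : nat -> C) : Cmod h <= 1 -> bounded_seq G ->
  (forall l, (G l + Csum (fun m => E l m (z0 + h) * G m) = gamma l)%C) ->
  (forall l, (l < N)%nat -> (x l + csum (fun j => s j l (z0 + h) * x j) N = G l)%C) ->
  let a l := (G l - csum (fun j => x j * s j l (z0 + h)) N)%C in
  forall l, (a l + Csum (fun m => A l m (z0 + h) * a m) = gamma l)%C.
Proof.
  intros Hh HG HGe Hx a l.
  rewrite A_split; [|auto|apply bounded_minus; [auto|apply s_sum_bounded; auto]].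
  rewrite Cplus_assoc; unfold a at 1 2.
  rewrite (tail_solution h G gamma x Hh HG HGe l).
  rewrite (csum_ext (fun m => A l m (z0 + h) * a m)%C (fun m => x m * A l m (z0 + h))%C);
    [ring|].
  intros m Hm; unfold a; rewrite <- (Hx m Hm).
  rewrite (csum_ext (fun j => x j * s j m (z0 + h))%C (fun j => s j m (z0 + h) * x j)%C)
    by (intros; ring).
  ring.
Qed.

(** Both [y] and minus the sum of y_j s_j solve the tail equation with right-hand side minus the sum
    of y_j A_lj over j < N, so they agree by [neumann_unique]. Thus a kernel vector is determined by
    its first [N] coordinates. *)
Lemma reduced_kernel (h : C) (y : nat -> C) : Cmod h <= 1 -> bounded_seq y ->
  (forall l, (y l + Csum (fun m => A l m (z0 + h) * y m) = 0)%C) ->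
  forall l, (y l + csum (fun j => s j l (z0 + h) * y j) N = 0)%C.
Proof.
  intros Hh Hy H.
  assert (H0 := tail_solution h (fun _ => RtoC 0) (fun _ => RtoC 0) y Hh
    bounded_0).
  set (w l := (0 - csum (fun j => y j * s j l (z0 + h)) N)%C) in H0.
  assert (Hw : bounded_seq w).
  { apply bounded_minus; [apply bounded_0|apply s_sum_bounded; auto]. }
  destruct (bounded_minus _ _ Hy Hw) as [X HX].
  assert (HX1 := Hy); destruct HX1 as [X1 HX1].
  assert (HX2 := Hw); destruct HX2 as [X2 HX2].
  assert (Hd := neumann_unique (fun l m => E l m (z0 + h)%C) _ X
    (fun l => E_absum l h Hh) HX).
  intros l; rewrite <- Hd with (l := l).
  - unfold w; rewrite (csum_ext (fun j => y j * s j l (z0 + h))%C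
      (fun j => s j l (z0 + h) * y j)%C) by (intros; ring); ring.
  - clear l; intros l.
    rewrite (Csum_ext _ (fun m => E l m (z0 + h) * y m + - (1) * (E l m (z0 + h) * w m))%C)
      by (intros; ring).
    erewrite Csum_plus, Csum_scal;
      [|apply absum_scal_bounded with (1 := HX2), E_absum; auto
       |apply absum_scal_bounded with (1 := HX1), E_absum; auto
       |apply absum_scal, absum_scal_bounded with (1 := HX2), E_absum; auto].
    assert (Hz : forall l0, (0 + Csum (fun m => E l0 m (z0 + h) * 0) = 0)%C).
    { intros l0; rewrite (Csum_ext _ (fun _ => RtoC 0)) by (intros; ring).
      rewrite Csum_0; ring. }
    specialize (H0 Hz l); specialize (H l); rewrite A_split in H by auto.
    transitivity ((y l + (Csum (fun m => E l m (z0 + h) * y m) +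
      csum (fun m => A l m (z0 + h) * y m) N)) -
      (w l + Csum (fun m => E l m (z0 + h) * w m)) -
      csum (fun m => A l m (z0 + h) * y m) N)%C; [ring|].
    rewrite H, H0, (csum_ext (fun m => A l m (z0 + h) * y m)%C
      (fun j => y j * A l j (z0 + h))%C) by (intros; ring); ring.
Qed.

(** The matrix of the reduced system for the first [N] coordinates, frozen at [z0]. *)
Let P (l j : nat) : C := ((if Nat.eq_dec j l then 1 else 0) + s j l z0)%C.

Lemma matvec_P (x : nat -> C) (l : nat) : (l < N)%nat ->
  matvec N P x l = (x l + csum (fun j => s j l z0 * x j) N)%C.
Proof.
  intros Hl; rewrite <- (csum_delta x l N Hl), <- csum_plus.
  apply csum_ext; intros k _; unfold P; destruct Nat.eq_dec; ring.
Qed.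

(** A kernel vector of [P] lifts to a kernel vector of I + A(z0) whose first [N] coordinates are
    those of [x]. *)
Lemma P_injective (x : nat -> C) : injective_at A z0 ->
  (forall l, (l < N)%nat -> matvec N P x l = 0) -> forall l, (l < N)%nat -> x l = 0.
Proof.
  intros Hinj Hx l Hl.
  assert (Hh : Cmod 0 <= 1) by (rewrite Cmod_0; lra).
  assert (E0 : (z0 + 0)%C = z0) by ring.
  assert (Ha := lifted_solution 0 (fun _ => RtoC 0) (fun _ => RtoC 0) x Hh
    bounded_0).
  assert (Ha2 := s_sum_bounded 0 x Hh).
  rewrite E0 in Ha, Ha2.
  assert (Ha3 := Hinj _ (bounded_minus _ _
    bounded_0 Ha2)).
  specialize (Hx l Hl) as Hxl; rewrite matvec_P in Hxl by auto.
  assert (Ha4 : (0 - csum (fun j => x j * s j l z0) N = 0)%C).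
  { apply Ha3; apply Ha.
    - intros l0; rewrite (Csum_ext _ (fun _ => RtoC 0)) by (intros; ring).
      rewrite Csum_0; ring.
    - intros l0 Hl0; rewrite <- matvec_P; auto. }
  transitivity (x l + csum (fun j => s j l z0 * x j) N +
    (0 - csum (fun j => x j * s j l z0) N))%C; [|rewrite Hxl, Ha4; ring].
  rewrite (csum_ext (fun j => x j * s j l z0)%C
    (fun j => s j l z0 * x j)%C) by (intros; ring); ring.
Qed.

Lemma ana_csum (rho : R) (F : nat -> C -> C) (M : nat -> R) (n : nat) : 0 <= rho ->
  (forall k, (k < n)%nat -> ana z0 rho (F k) (M k)) ->
  ana z0 rho (fun z => csum (fun k => F k z) n) (rsum M n).
Proof.
  intros Hr; induction n as [|n IH]; intros H; simpl.
  - apply ana_le with (1 := ana_const z0 rho 0); rewrite Cmod_0; lra.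
  - apply ana_plus; auto.
Qed.

(** The reduced system is invertible at [z0] and its matrix varies little nearby, so a second
    Neumann series solves it analytically. The same smallness keeps I + A injective on the disc,
    which later makes the domain open. *)
Lemma analytic_fredholm_split : injective_at A z0 ->
  exists (rho beta' : R) (a : nat -> C -> C), 0 < rho <= 1 /\
    (forall l, ana z0 rho (a l) beta') /\
    forall h, Cmod h <= rho -> injective_at A (z0 + h)%C /\
      forall l, (a l (z0 + h) + Csum (fun m => A l m (z0 + h) * a m (z0 + h)) = g l (z0 + h))%C.
Proof.
  intros Hinj.
  destruct (injective_matrix_inverse N P (fun x => P_injective x Hinj)) as (Q & HQ).
  set (q l := rsum (fun k => Cmod (Q l k)) N).
  set (Qtot := rsum q N).
  assert (q_pos : forall l, 0 <= q l) by (intros; apply rsum_pos; intros; apply Cmod_ge_0).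
  assert (Qtot_pos : 0 <= Qtot) by (apply rsum_pos; auto).
  assert (q_le : forall l, (l < N)%nat -> q l <= Qtot).
  { intros l Hl; apply Rle_trans with (rsum q (S l)); [apply rsum_term; auto|].
    apply rsum_mono; auto. }
  assert (B_pos : 0 <= B) by apply (bnd_pos _ _ Hb).
  assert (beta_pos : 0 <= beta) by exact (ana_pos _ _ _ _ (Hg O)).
  (* With rho = 1/D, the [N] column bounds [rho * (2 * B) * Qtot] add up to at most 1/2; the summand
     1 keeps [rho] at most 1. *)
  set (D := 4 * B * INR N * Qtot + 1).
  assert (HD : 1 <= D).
  { unfold D; pose proof (pos_INR N).
    enough (0 <= 4 * B * INR N * Qtot) by lra.
    repeat apply Rmult_le_pos; lra. }
  set (rho := / D).
  assert (Hrho : 0 < rho <= 1).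
  { split; [apply Rinv_0_lt_compat; lra|rewrite <- Rinv_1; apply Rinv_le_contravar; lra]. }
  set (S0 l z := neumann E g l z).
  assert (HS : forall l, ana z0 1 (S0 l) (2 * beta))
    by (intros l; apply (ana_neumann z0 1 r01 E _ HE (fun _ => HN) g beta Hg)).
  set (Dif k j z := (s j k z - s j k z0)%C).
  assert (HDif : forall k j, ana z0 rho (Dif k j) (rho / 1 * (2 * B)))
    by (intros k j; apply ana_increment; [lra|lra|lra|apply Hs]).
  (* [Q] times the change of the reduced matrix from [z0] to [z], extended by zero so that the
     results on infinite matrices apply to the finite system. *)
  set (E' l j z := if lt_dec l N then if lt_dec j N then
    csum (fun k => Q l k * Dif k j z)%C N else RtoC 0 else RtoC 0).
  set (e' := fun j => if lt_dec j N then rho * (2 * B) * Qtot else 0).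
  assert (HE' : forall l j, ana z0 rho (E' l j) (e' j)).
  { assert (H0 : ana z0 rho (fun _ => RtoC 0) 0)
      by (apply ana_le with (1 := ana_const z0 rho 0); rewrite Cmod_0; lra).
    intros l j; unfold E', e'.
    destruct (lt_dec j N) as [Hj|Hj]; destruct (lt_dec l N) as [Hl|Hl]; auto.
    - eapply ana_le; [apply (ana_csum rho _ (fun k => rho / 1 * (2 * B) * Cmod (Q l k)))|].
      + lra.
      + intros k _; rewrite Rmult_comm; apply ana_scal, HDif.
      + rewrite rsum_scal; unfold Rdiv; rewrite Rinv_1, Rmult_1_r.
        apply Rmult_le_compat_l; [|apply q_le; auto].
        apply Rmult_le_pos; lra.
    - apply ana_le with (1 := H0).
      repeat apply Rmult_le_pos; lra. }
  assert (He' : bnd e' (/ 2)).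
  { assert (e'_pos : forall j, 0 <= e' j) by exact (fun j => ana_pos _ _ _ _ (HE' O j)).
    assert (H1 : rsum e' N <= / 2).
    { rewrite (rsum_ext _ (fun _ => rho * (2 * B) * Qtot))
        by (intros k Hk; unfold e'; destruct lt_dec; [auto|lia]).
      replace (rsum _ N) with (INR N * (rho * (2 * B) * Qtot)).
      - apply Rmult_le_reg_l with (2 * D); [lra|].
        unfold rho; replace (2 * D * (INR N * (/ D * (2 * B) * Qtot)))
          with (4 * B * INR N * Qtot) by (field; lra).
        unfold D; lra.
      - generalize (rho * (2 * B) * Qtot); clear; intros t.
        induction N as [|n IH]; [simpl; ring|].
        rewrite S_INR; simpl; rewrite <- IH; ring. }
    intros n; apply Rle_trans with (rsum e' (n + N)%nat); [apply rsum_mono; auto; lia|].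
    clear -H1; induction n as [|n IH]; simpl; [auto|].
    unfold e' at 2; destruct lt_dec; [lia|lra]. }
  set (g' l z := if lt_dec l N then csum (fun k => Q l k * S0 k z)%C N else RtoC 0).
  assert (Hg' : forall l, ana z0 rho (g' l) (2 * beta * Qtot)).
  { intros l; unfold g'; destruct (lt_dec l N) as [Hl|Hl].
    - eapply ana_le; [apply (ana_csum rho _ (fun k => 2 * beta * Cmod (Q l k)))|].
      + lra.
      + intros k _; rewrite Rmult_comm; apply ana_scal, ana_shrink with 1; [lra|apply HS].
      + rewrite rsum_scal; apply Rmult_le_compat_l; [lra|apply q_le; auto].
    - apply ana_le with (1 := ana_const z0 rho 0); rewrite Cmod_0.
      repeat apply Rmult_le_pos; lra. }
  assert (rho_pos : 0 <= rho) by lra.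
  set (x l z := neumann E' g' l z).
  assert (Hx : forall l, ana z0 rho (x l) (2 * (2 * beta * Qtot)))
    by (intros l; apply (ana_neumann z0 rho rho_pos E' _ HE' (fun _ => He') g' _ Hg')).
  (* Multiplying by Q turns the first N equations into a perturbation of the
     identity, which is small near z0. *)
  assert (HQP : forall (h : C) (y : nat -> C) l, (l < N)%nat ->
    matvec N Q (fun k => y k + csum (fun j => s j k (z0 + h) * y j) N)%C l =
    (y l + Csum (fun j => E' l j (z0 + h) * y j))%C).
  { intros h y l Hl.
    rewrite (matvec_ext _ Q _ (fun k => matvec N P y k +
      matvec N (fun k j => Dif k j (z0 + h)%C) y k)%C).
    - rewrite matvec_plus, (proj2 (HQ y l Hl)); f_equal.
      rewrite matvec_matvec, (Csum_finite _ N).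
      + apply csum_ext; intros j Hj; unfold E'.
        destruct lt_dec; [|lia]; destruct lt_dec; [auto|lia].
      + intros j Hj; unfold E'; destruct lt_dec; [|ring].
        destruct lt_dec; [lia|ring].
    - intros k Hk; rewrite matvec_P by auto; unfold matvec.
      rewrite <- Cplus_assoc, <- csum_plus; f_equal.
      apply csum_ext; intros; unfold Dif; ring. }
  exists rho, (2 * beta + rsum (fun _ => 2 * (2 * beta * Qtot) * (2 * B)) N),
    (fun l z => S0 l z - csum (fun j => x j z * s j l z) N)%C.
  split; [auto|split].
  - intros l; apply ana_plus; [auto|apply ana_shrink with 1; [lra|apply HS]|].
    apply ana_opp, ana_csum; auto; intros j _; apply ana_mult; auto.
    apply ana_shrink with 1; [lra|apply Hs].
  - intros h Hh; assert (Hh1 : Cmod h <= 1) by lra; split.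
    + intros y Hy Hker.
      assert (Hred := reduced_kernel h y Hh1 Hy Hker).
      destruct Hy as [Y HY].
      assert (Hlow : forall l, (l < N)%nat -> y l = 0).
      { intros l Hl.
        (* [E'] sees only the first [N] coordinates; after truncation the equation reads 0 = 0 in
           all the others. *)
        set (y' l := if lt_dec l N then y l else RtoC 0).
        replace (y l) with (y' l) by (unfold y'; destruct lt_dec; [auto|lia]).
        apply (neumann_unique (fun l j => E' l j (z0 + h)%C) y' Y).
        - intros l'; apply absum_dom with (1 := He'); intros m.
          apply (ana_bound z0 rho); auto.
        - intros l'; unfold y'; destruct lt_dec; auto.
          rewrite Cmod_0; eapply Rle_trans; [apply Cmod_ge_0|apply (HY O)].
        - intros l'; destruct (lt_dec l' N) as [Hl'|Hl'].
          + rewrite <- HQP by auto; unfold matvec.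
            rewrite csum_zero; auto; intros k Hk.
            rewrite (csum_ext _ (fun j => s j k (z0 + h) * y j)%C).
            * unfold y'; destruct lt_dec; [|lia]; rewrite Hred; ring.
            * intros j Hj; unfold y'; destruct lt_dec; [auto|lia].
          + rewrite (Csum_ext _ (fun _ => RtoC 0)).
            * rewrite Csum_0; unfold y'; destruct lt_dec; [lia|ring].
            * intros m; unfold E'; destruct lt_dec; [lia|ring]. }
      intros l; rewrite <- (Hred l), csum_zero; [ring|].
      intros k Hk; rewrite Hlow by auto; ring.
    + apply (lifted_solution h (fun l => S0 l (z0 + h)%C) (fun l => g l (z0 + h)%C)
        (fun l => x l (z0 + h)%C) Hh1).
      * exists (2 * beta); intros l; apply (ana_bound z0 1); auto.
      * intros l; apply (neumann_eq z0 1 r01 E _ HE (fun _ => HN) g beta Hg); auto.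
      * intros l Hl.
        (* [x] was built to solve the reduced system multiplied by [Q]; applying [P] gives the
           system itself back, since P Q = I. *)
        set (v := fun l => (x l (z0 + h) + csum (fun j => s j l (z0 + h) * x j (z0 + h)) N)%C).
        change (v l = S0 l (z0 + h)%C).
        rewrite <- (proj1 (HQ v l Hl)), <- (proj1 (HQ (fun k => S0 k (z0 + h)%C) l Hl)).
        apply matvec_ext; intros k Hk; unfold v.
        rewrite (HQP h (fun l => x l (z0 + h)%C)) by auto.
        rewrite (neumann_eq z0 rho rho_pos E' _ HE' (fun _ => He') g' _ Hg') by auto.
        unfold g'; destruct lt_dec; [auto|lia].
Qed.

End Fredholm.

(** Summability of the column bounds supplies an [N] beyond which they add up to at most 1/2. *)
Theorem analytic_fredholm (A : nat -> nat -> C -> C) (b : nat -> R) (B : R) (z0 : C)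
    (g : nat -> C -> C) (beta : R) :
  (forall l m, ana z0 1 (A l m) (b m)) -> bnd b B -> (forall l, ana z0 1 (g l) beta) ->
  injective_at A z0 ->
  exists (rho beta' : R) (a : nat -> C -> C), 0 < rho <= 1 /\
    (forall l, ana z0 rho (a l) beta') /\
    forall h, Cmod h <= rho -> injective_at A (z0 + h)%C /\
      forall l, (a l (z0 + h) + Csum (fun m => A l m (z0 + h) * a m (z0 + h)) = g l (z0 + h))%C.
Proof.
  intros HA Hb Hg Hinj.
  destruct (bnd_eventually_zero b B (mkposreal (/ 2) ltac:(lra))) as [N HN]; auto.
  - intros m; exact (ana_pos _ _ _ _ (HA O m)).
  - apply analytic_fredholm_split with b B beta N; auto.
Qed.

(** * A lower bound for the Gamma function *)

Section GammaBound.
Variable x : R.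
Hypothesis x_gt_1 : 1 < x.

Let phi (t : R) : R := Rpower t (x - 1) * exp (- t).

Lemma gamma_integrand_pos (t : R) : 0 < phi t.
Proof. apply Rmult_lt_0_compat; apply exp_pos. Qed.

Lemma gamma_integrand_continuous (t : R) : 0 < t -> continuous phi t.
Proof.
  intros Ht; apply (@ex_derive_continuous R_AbsRing R_NormedModule).
  unfold phi, Rpower; auto_derive; auto.
Qed.

Lemma gamma_integrand_integrable (a b : R) : 0 < a -> a <= b -> ex_RInt phi a b.
Proof.
  intros Ha Hab; apply (@ex_RInt_continuous R_CompleteNormedModule).
  intros t Ht; apply gamma_integrand_continuous.
  rewrite Rmin_left in Ht by lra; lra.
Qed.

(** From ln v <= v at v = t/(2(x-1)): half of the exponential decay absorbs the power of t, and what
    remains can be integrated in closed form. *)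
Lemma gamma_integrand_le (t : R) : 0 < t ->
  phi t <= exp ((x - 1) * ln (2 * (x - 1))) * exp (- (t / 2)).
Proof.
  intros Ht; unfold phi, Rpower; rewrite <- !exp_plus.
  set (y := x - 1); assert (Hy : 0 < y) by (unfold y; lra).
  assert (H : ln (t / (2 * y)) <= t / (2 * y)).
  { assert (H0 : 0 < t / (2 * y)) by (apply Rdiv_lt_0_compat; lra).
    pose proof (exp_ineq1_le (ln (t / (2 * y)))) as H1; rewrite exp_ln in H1 by auto; lra. }
  rewrite ln_div in H by lra.
  apply (Rmult_le_compat_l y) in H; [|lra].
  replace (y * (t / (2 * y))) with (t / 2) in H by (field; lra).
  assert (H2 : y * ln t + - t <= y * ln (2 * y) + - (t / 2)) by lra.
  destruct H2 as [H2|H2]; [left; apply exp_increasing; auto|rewrite H2; lra].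
Qed.

Lemma gamma_partial_bounded (a b : R) : 0 < a -> a <= b ->
  RInt phi a b <= 2 * exp ((x - 1) * ln (2 * (x - 1))).
Proof.
  intros Ha Hab; set (c := exp ((x - 1) * ln (2 * (x - 1)))).
  assert (Hc : 0 < c) by apply exp_pos.
  assert (HI : is_RInt (fun t => c * exp (- (t / 2))) a b
    (minus (- 2 * c * exp (- (b / 2))) (- 2 * c * exp (- (a / 2))))).
  { apply (is_RInt_derive (fun t => - 2 * c * exp (- (t / 2)))).
    - intros t _; auto_derive; auto; unfold Rdiv; field.
    - intros t _; apply (@ex_derive_continuous R_AbsRing R_NormedModule); auto_derive; auto. }
  apply Rle_trans with (RInt (fun t => c * exp (- (t / 2))) a b).
  - apply RInt_le; auto.
    + apply gamma_integrand_integrable; auto.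
    + eexists; apply HI.
    + intros t Ht; apply gamma_integrand_le; lra.
  - rewrite (is_RInt_unique _ _ _ _ HI).
    unfold minus, plus, opp; simpl.
    pose proof (exp_pos (- (b / 2))).
    assert (exp (- (a / 2)) <= 1) by (rewrite <- exp_0; left; apply exp_increasing; lra).
    assert (0 <= c * exp (- (b / 2))) by (apply Rmult_le_pos; lra).
    assert (c * exp (- (a / 2)) <= c * 1) by (apply Rmult_le_compat_l; lra).
    lra.
Qed.

Lemma gamma_partial_mono (a a' b b' : R) : 0 < a' -> a' <= a -> a <= b -> b <= b' ->
  RInt phi a b <= RInt phi a' b'.
Proof.
  intros H1 H2 H3 H4.
  rewrite <- (RInt_Chasles phi a' a b') by (apply gamma_integrand_integrable; lra).
  rewrite <- (RInt_Chasles phi a b b') by (apply gamma_integrand_integrable; lra).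
  unfold plus; simpl.
  assert (0 <= RInt phi a' a).
  { apply RInt_ge_0; [lra|apply gamma_integrand_integrable; lra|].
    intros; left; apply gamma_integrand_pos. }
  assert (0 <= RInt phi b b').
  { apply RInt_ge_0; [lra|apply gamma_integrand_integrable; lra|].
    intros; left; apply gamma_integrand_pos. }
  lra.
Qed.

(** Nothing can be said about the value of [Gamma] before the improper integral is known to
    converge. The integrals of a positive function grow with the interval and are bounded here, so
    they converge to their supremum. *)
Lemma Gamma_ge_partial (a b : R) : 0 < a -> a <= b -> RInt phi a b <= Gamma x.
Proof.
  intros Ha Hab.
  destruct (completeness (fun v => exists a b, 0 < a <= b /\ v = RInt phi a b)) as [L [HL1 HL2]].
  - exists (2 * exp ((x - 1) * ln (2 * (x - 1)))); intros v (a' & b' & H & ->).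
    apply gamma_partial_bounded; lra.
  - exists (RInt phi 1 1), 1, 1; split; [lra|auto].
  - enough (E : Gamma x = L) by (rewrite E; apply HL1; exists a, b; auto).
    unfold Gamma; apply is_RInt_gen_unique; fold phi.
    intros S [eps HS].
    assert (H : exists a0 b0, 0 < a0 <= b0 /\ L - eps < RInt phi a0 b0).
    { apply NNPP; intros Hn.
      assert (Hu : L <= L - eps); [|destruct eps; simpl in Hu; lra].
      apply HL2; intros v (a0 & b0 & H & ->); apply Rnot_lt_le; intros Hlt.
      apply Hn; exists a0, b0; auto. }
    destruct H as (a0 & b0 & H0 & H1).
    apply Filter_prod with (fun t => 0 < t < a0) (fun t => b0 < t).
    + exists (mkposreal a0 (proj1 H0)); intros y Hy Hy0; split; auto.
      apply Rabs_def2 in Hy; unfold minus, plus, opp in Hy; simpl in Hy; lra.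
    + exists b0; auto.
    + intros a' b' Ha' Hb'; exists (RInt phi a' b'); split.
      * apply (@RInt_correct R_CompleteNormedModule), gamma_integrand_integrable; simpl; lra.
      * apply HS; apply Rabs_def1; unfold minus, plus, opp; simpl.
        -- assert (RInt phi a' b' <= L) by (apply HL1; exists a', b'; split; [lra|auto]).
           destruct eps; simpl in *; lra.
        -- pose proof (gamma_partial_mono a0 a' b0 b'); destruct eps; simpl in *; lra.
Qed.

(** Only the interval [r, r+1] is kept. As [r] is free, Gamma outgrows every exponential, and this
    takes the place of Stirling's formula. *)
Lemma Gamma_lower (r : R) : 1 <= r -> Rpower r (x - 1) * exp (- (r + 1)) <= Gamma x.
Proof.
  intros Hr; apply Rle_trans with (RInt phi r (r + 1)); [|apply Gamma_ge_partial; lra].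
  replace (Rpower _ _ * _) with
    (RInt (fun _ => Rpower r (x - 1) * exp (- (r + 1))) r (r + 1)).
  - apply RInt_le; [lra|apply ex_RInt_const|apply gamma_integrand_integrable; lra|].
    intros t Ht; unfold phi; apply Rmult_le_compat; try (left; apply exp_pos).
    + apply Rle_Rpower_l; lra.
    + left; apply exp_increasing; lra.
  - rewrite RInt_const; unfold scal; simpl; unfold mult; simpl; ring.
Qed.

End GammaBound.

(** * The Riccati-Bessel functions as entire functions *)

(** The coefficient of z^(2k+l) in v_l: the square root in front of the Bessel function and the
    half-integer power in its series combine to sqrt(pi) z/2. *)
Definition bessel_coeff (l k : nat) : R :=
  sqrt PI / 2 * ((-1) ^ k / (INR (fact k) * Gamma (INR k + (INR l + / 2) + 1)))
    * (/ 2) ^ (2 * k + l).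

(** [Gamma_lower] at k + l + 3/2 gives the power of [r]; the factorial and the powers of 1/2 are
    estimated by 1. *)
Lemma bessel_coeff_bound (r : R) (l k : nat) : 1 <= r ->
  Rabs (bessel_coeff l k) <= sqrt PI / 2 * exp (r + 1) * (/ r) ^ (k + l).
Proof.
  intros Hr; unfold bessel_coeff.
  assert (HG : r ^ (k + l) * exp (- (r + 1)) <= Gamma (INR k + (INR l + / 2) + 1)).
  { pose proof (pos_INR k); pose proof (pos_INR l).
    eapply Rle_trans; [|apply (fun H => Gamma_lower _ H r Hr); lra].
    apply Rmult_le_compat_r; [left; apply exp_pos|].
    rewrite <- Rpower_pow, plus_INR by lra; apply Rle_Rpower; lra. }
  assert (Hp : 0 < r ^ (k + l)) by (apply pow_lt; lra).
  assert (HG0 : 0 < r ^ (k + l) * exp (- (r + 1)))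
    by (apply Rmult_lt_0_compat; [auto|apply exp_pos]).
  assert (Hf : 1 <= INR (fact k)) by (apply (le_INR 1); apply lt_O_fact).
  assert (HPI : 0 <= sqrt PI / 2) by (pose proof (sqrt_pos PI); lra).
  assert (H2 : (/ 2) ^ (2 * k + l) <= 1)
    by (rewrite <- (pow1 (2 * k + l)); apply pow_incr; lra).
  assert (H2' : 0 <= (/ 2) ^ (2 * k + l)) by (apply pow_le; lra).
  rewrite !Rabs_mult, (Rabs_pos_eq _ HPI), (Rabs_pos_eq _ H2').
  unfold Rdiv at 2; rewrite Rabs_mult, pow_1_abs, Rmult_1_l.
  set (G := Gamma _) in *.
  assert (HfG : r ^ (k + l) * exp (- (r + 1)) <= INR (fact k) * G).
  { apply Rle_trans with (1 * G); [lra|apply Rmult_le_compat_r; lra]. }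
  rewrite Rabs_pos_eq by (left; apply Rinv_0_lt_compat; lra).
  apply Rle_trans with (sqrt PI / 2 * / (r ^ (k + l) * exp (- (r + 1))) * 1).
  - apply Rmult_le_compat; auto.
    + apply Rmult_le_pos; auto; left; apply Rinv_0_lt_compat; lra.
    + apply Rmult_le_compat_l; auto; apply Rinv_le_contravar; auto.
  - rewrite exp_Ropp, Rinv_mult, Rinv_inv, pow_inv; lra.
Qed.

(** The rate [q] is arbitrary; it will be taken small enough to beat the growth of c_l. *)
Lemma bessel_coeff_bnd (rho q : R) : 0 <= rho -> 0 < q ->
  exists C0, 0 <= C0 /\ forall l, bnd (fun k => Rabs (bessel_coeff l k) * rho ^ (2 * k + l)) (C0 * q ^ l).
Proof.
  intros Hrho Hq.
  assert (Hrq : 0 <= rho / q) by (apply Rdiv_le_0_compat; auto).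
  assert (Hr2 : 0 <= rho * rho) by (apply Rmult_le_pos; auto).
  (* Makes rho/r at most [q], for the decay in [l], and rho^2/r at most 1/2, for the geometric
     series in [k]. *)
  set (r := 1 + 2 * (rho * rho) + rho / q).
  assert (Hr : 1 <= r) by (unfold r; lra).
  set (M := sqrt PI / 2 * exp (r + 1)).
  assert (HM : 0 <= M).
  { apply Rmult_le_pos; [pose proof (sqrt_pos PI); lra|left; apply exp_pos]. }
  exists (M * 2); split; [lra|]; intros l.
  apply bnd_dom with (fun k => M * q ^ l * (/ 2) ^ k).
  - replace (M * 2 * q ^ l) with (M * q ^ l * 2) by ring.
    apply bnd_scal; [|apply bnd_geom].
    apply Rmult_le_pos; [auto|apply pow_le; lra].
  - intros k; apply Rle_trans with (M * (/ r) ^ (k + l) * rho ^ (2 * k + l)).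
    + apply Rmult_le_compat_r; [apply pow_le; auto|apply bessel_coeff_bound; auto].
    + rewrite !pow_add, pow_mult.
      replace (M * ((/ r) ^ k * (/ r) ^ l) * ((rho ^ 2) ^ k * rho ^ l))
        with (M * (((/ r) * rho) ^ l * (/ r * rho ^ 2) ^ k)) by (rewrite !Rpow_mult_distr; ring).
      rewrite Rmult_assoc; apply Rmult_le_compat_l; auto.
      assert (Hir : 0 < / r) by (apply Rinv_0_lt_compat; lra).
      apply Rmult_le_compat; try (apply pow_le).
      * apply Rmult_le_pos; lra.
      * simpl; apply Rmult_le_pos; lra.
      * apply pow_incr; split; [apply Rmult_le_pos; lra|].
        apply Rmult_le_reg_l with r; [lra|].
        rewrite <- Rmult_assoc, Rinv_r, Rmult_1_l by lra.
        apply Rle_trans with (rho / q * q); [right; field; lra|].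
        apply Rmult_le_compat_r; unfold r; lra.
      * apply pow_incr; split; [simpl; apply Rmult_le_pos; lra|].
        apply Rmult_le_reg_l with r; [lra|].
        rewrite <- Rmult_assoc, Rinv_r, Rmult_1_l by lra.
        unfold r; simpl; lra.
Qed.

(* [uC l] extends [u l] to the complex plane, and [vC l z] is [uC l z / z]. *)
Definition vC (l : nat) (z : C) : C :=
  Csum (fun k => (RtoC (bessel_coeff l k) * z ^ (2 * k + l))%C).

Definition uC (l : nat) (z : C) : C := (z * vC l z)%C.

Lemma Csum_RtoC (x : nat -> R) : Csum (fun k => RtoC (x k)) = RtoC (Series x).
Proof.
  unfold Csum, RtoC; simpl; f_equal.
  rewrite (Series_ext _ (fun _ => 0 * 0)) by (intros; ring).
  rewrite Series_scal_l; ring.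
Qed.

(** For r > 0 the series agree termwise once the two factors sqrt (r/2) are multiplied; at 0 both
    sides vanish, through the factors z and sqrt r. *)
Lemma uC_RtoC (l : nat) (r : R) : 0 <= r -> uC l (RtoC r) = RtoC (u l r).
Proof.
  intros [Hr|<-].
  - unfold uC, vC.
    rewrite (Csum_ext _ (fun k => RtoC (bessel_coeff l k * r ^ (2 * k + l))))
      by (intros; rewrite RtoC_mult, RtoC_pow; auto).
    rewrite Csum_RtoC, <- RtoC_mult; f_equal.
    unfold u, BesselJ; rewrite <- !Series_scal_l; apply Series_ext; intros k.
    unfold bessel_coeff.
    replace (2 * INR k + (INR l + / 2)) with (INR (2 * k + l) + / 2)
      by (rewrite plus_INR, mult_INR; simpl; ring).
    rewrite Rpower_plus, Rpower_pow, Rpower_sqrt by lra.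
    replace (PI * r / 2) with (PI * (r / 2)) by field.
    rewrite sqrt_mult by (pose proof PI_RGT_0; lra).
    replace ((r / 2) ^ (2 * k + l)) with (r ^ (2 * k + l) * (/ 2) ^ (2 * k + l))
      by (unfold Rdiv; rewrite Rpow_mult_distr; auto).
    set (e := (-1) ^ k / _).
    transitivity (sqrt PI * (sqrt (r / 2) * sqrt (r / 2)) * e * r ^ (2 * k + l) * (/ 2) ^ (2 * k + l));
      [rewrite sqrt_sqrt by lra; field|ring].
  - unfold uC, u; rewrite Rmult_0_r; unfold Rdiv; rewrite Rmult_0_l, sqrt_0, Rmult_0_l; ring.
Qed.

Lemma vC_ana (z0 : C) (rho M : R) (l : nat) : 0 <= rho ->
  bnd (fun k => Rabs (bessel_coeff l k) * (Cmod z0 + rho) ^ (2 * k + l)) M ->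
  ana z0 rho (vC l) M.
Proof.
  intros Hr H; apply ana_sum with (3 := H); auto; intros k.
  rewrite <- Cmod_R; apply ana_scal, ana_pow; auto.
Qed.

Lemma f_Csum (c : nat -> C) (r s : R) : 0 <= r -> 0 <= s ->
  Defs.f c r s = Csum (fun l => (c l * uC l (RtoC r) * uC l (RtoC s))%C).
Proof.
  intros Hr Hs; unfold Defs.f, Csum; f_equal; apply Series_ext; intros l;
    rewrite !uC_RtoC by auto; unfold Re, Im, Cmult, RtoC; simpl; ring.
Qed.

(** * Termwise integration *)

(** The bound depends on the majorant [b] alone, so for a series of functions it gives uniform
    convergence, as in the Weierstrass test. *)
Lemma Cmod_csum_tail (a : nat -> C) (b : nat -> R) (eps : R) (N n : nat) :
  (forall k, Cmod (a k) <= b k) -> bnd (fun k => if lt_dec k N then 0 else b k) eps ->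
  (N <= n)%nat -> Cmod (csum a n - Csum a) <= eps.
Proof.
  intros Hab H Hn.
  assert (H1 : absum (fun k => if lt_dec k n then RtoC 0 else a k) eps).
  { apply absum_dom with (1 := H); intros k.
    assert (0 <= b k) by (eapply Rle_trans; [apply Cmod_ge_0|apply Hab]).
    destruct (lt_dec k n); destruct (lt_dec k N); rewrite ?Cmod_0; auto; try lra; lia. }
  assert (H2 : absum (fun k => if lt_dec k n then a k else RtoC 0)
    (rsum (fun k => Cmod (if lt_dec k n then a k else RtoC 0)) n)).
  { apply absum_finite; intros k Hk; destruct lt_dec; [lia|auto]. }
  replace (csum a n - Csum a)%C with (- Csum (fun k => if lt_dec k n then RtoC 0 else a k))%C.
  - rewrite Cmod_opp; apply Cmod_Csum; auto.
  - replace (Csum a) with (csum a n + Csum (fun k => if lt_dec k n then RtoC 0 else a k))%C;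
      [ring|].
    rewrite (Csum_ext a (fun k => (if lt_dec k n then a k else RtoC 0) +
      (if lt_dec k n then RtoC 0 else a k))%C) by (intros; destruct lt_dec; ring).
    rewrite (Csum_plus _ _ _ _ H2 H1); f_equal.
    rewrite (Csum_finite _ n).
    + apply csum_ext; intros k Hk; destruct lt_dec; [auto|lia].
    + intros k Hk; destruct lt_dec; [lia|auto].
Qed.

(** Balls of the product structure on C are squares, which costs a factor sqrt 2 <= 2 against the
    modulus; hence eps/2. *)
Lemma Cconv_of_filterlim (s : nat -> C) (l : C) :
  filterlim s eventually (locally (T := C_R_NormedModule) l) -> Cconv s l.
Proof.
  intros H; apply is_lim_seq_spec; intros eps.
  pose proof (proj1 (filterlim_locally s l) H (pos_div_2 eps)) as [N HN].
  exists N; intros n Hn; rewrite Rminus_0_r, Rabs_pos_eq by apply Cmod_ge_0.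
  eapply Rlt_le_trans; [apply (C_NormedModule_mixin_compat2 _ _ _ (HN n Hn))|]; simpl.
  assert (sqrt 2 <= 2) by (rewrite <- (sqrt_square 2) at 2 by lra; apply sqrt_le_1; lra).
  destruct eps as [e He]; simpl.
  apply Rle_trans with (2 * (e / 2)); [apply Rmult_le_compat_r|]; lra.
Qed.

Lemma filterlim_of_Cconv (s : nat -> C) (l : C) :
  Cconv s l -> filterlim s eventually (locally l).
Proof.
  intros H; apply filterlim_locally; intros eps.
  apply is_lim_seq_spec in H; destruct (H eps) as [N HN].
  exists N; intros n Hn; apply C_NormedModule_mixin_compat1.
  specialize (HN n Hn); rewrite Rminus_0_r, Rabs_pos_eq in HN by apply Cmod_ge_0; exact HN.
Qed.

Lemma is_RInt_csum (g : nat -> R -> C) (a b : R) (I : nat -> C) (n : nat) :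
  (forall m, is_RInt (V := C_R_NormedModule) (g m) a b (I m)) ->
  is_RInt (V := C_R_NormedModule) (fun t => csum (fun m => g m t) n) a b (csum I n).
Proof.
  intros H; induction n as [|n IH].
  - pose proof (@is_RInt_const C_R_NormedModule a b (RtoC 0)) as H0.
    refine (eq_ind _ (fun v : C => is_RInt (V := C_R_NormedModule) _ a b v) H0 (RtoC 0) _).
    unfold scal; simpl; unfold prod_scal, RtoC; simpl; unfold scal; simpl; unfold mult; simpl.
    f_equal; ring.
  - exact (@is_RInt_plus C_R_NormedModule _ _ _ _ _ _ IH (H n)).
Qed.

Lemma is_RInt_Csum (g : nat -> R -> C) (b : nat -> R) (B r : R) (I : nat -> C) (BI : R) :
  0 <= r -> (forall m t, 0 <= t <= r -> Cmod (g m t) <= b m) -> bnd b B ->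
  (forall m, is_RInt (V := C_R_NormedModule) (g m) 0 r (I m)) -> absum I BI ->
  is_RInt (V := C_R_NormedModule) (fun t => Csum (fun m => g m t)) 0 r (Csum I).
Proof.
  intros Hr Hg Hb HI HBI.
  (* The limit theorem for integrals asks for uniform convergence on all of R, so the terms are cut
     off outside [0, r]. *)
  set (dom t := if Rle_dec 0 t then if Rle_dec t r then true else false else false).
  set (g' m t := if dom t then g m t else RtoC 0).
  assert (Hdom : forall t, 0 < t < r -> dom t = true)
    by (intros t Ht; unfold dom; destruct Rle_dec; [|lra]; destruct Rle_dec; [auto|lra]).
  assert (b_pos : forall m, 0 <= b m).
  { intros m; eapply Rle_trans; [apply Cmod_ge_0|apply (Hg m 0); lra]. }
  assert (Hg' : forall m t, Cmod (g' m t) <= b m).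
  { intros m t; unfold g', dom; destruct Rle_dec; [destruct Rle_dec|]; auto;
      rewrite Cmod_0; auto. }
  assert (HI' : forall m, is_RInt (V := C_R_NormedModule) (g' m) 0 r (I m)).
  { intros m; apply is_RInt_ext with (2 := HI m); intros t.
    rewrite Rmin_left, Rmax_right by lra; intros Ht; unfold g'; rewrite Hdom; auto. }
  destruct (@filterlim_RInt nat C_R_CompleteNormedModule
    (fun n t => csum (fun m => g' m t) n) 0 r eventually _
    (fun t => Csum (fun m => g' m t)) (fun n => csum I n)) as (If & HIf & Hint).
  - intros n; exact (is_RInt_csum g' 0 r I n HI').
  - apply (filterlim_locally (U := fct_UniformSpace R C_R_CompleteNormedModule)); intros eps.
    destruct (bnd_eventually_zero b B (pos_div_2 eps) b_pos Hb) as [N HN].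
    exists N; intros n Hn t; apply C_NormedModule_mixin_compat1.
    eapply Rle_lt_trans; [apply (Cmod_csum_tail (fun m => g' m t) b _ N n (fun k => Hg' k t) HN Hn)|].
    destruct eps; simpl; lra.
  - rewrite (Cconv_unique _ _ _ (Csum_conv _ _ HBI) (Cconv_of_filterlim _ _ HIf)).
    refine (is_RInt_ext _ _ _ _ _ _ Hint); intros t.
    rewrite Rmin_left, Rmax_right by lra; intros Ht.
    apply Csum_ext; intros m; unfold g'; rewrite Hdom; auto.
Qed.

(** C is a normed module over R here, so linearity of the integral covers real scalars; a complex
    factor goes through the components. *)
Lemma is_RInt_Cmult (c : C) (g : R -> C) (a b : R) (I : C) :
  is_RInt (V := C_R_NormedModule) g a b I ->
  is_RInt (V := C_R_NormedModule) (fun t => (c * g t)%C) a b (c * I)%C.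
Proof.
  intros H.
  pose proof (is_RInt_fct_extend_fst _ _ _ _ H) as H1.
  pose proof (is_RInt_fct_extend_snd _ _ _ _ H) as H2.
  apply (@is_RInt_fct_extend_pair R_NormedModule R_NormedModule); simpl.
  - apply (@is_RInt_minus R_NormedModule); apply (@is_RInt_scal R_NormedModule); auto.
  - apply (@is_RInt_plus R_NormedModule); apply (@is_RInt_scal R_NormedModule); auto.
Qed.

Lemma is_RInt_Cpow (r : R) (p : nat) :
  is_RInt (V := C_R_NormedModule) (fun t => (RtoC t ^ p)%C) 0 r
    (RtoC (/ INR (p + 1)) * RtoC r ^ (p + 1))%C.
Proof.
  assert (Hp : INR (p + 1) <> 0) by (apply not_0_INR; lia).
  rewrite <- RtoC_pow, <- RtoC_mult.
  apply is_RInt_ext with (fun t => RtoC (t ^ p)); [intros; apply RtoC_pow|].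
  apply (@is_RInt_fct_extend_pair R_NormedModule R_NormedModule); simpl.
  - replace (/ INR (p + 1) * r ^ (p + 1)) with
      (minus (/ INR (p + 1) * r ^ (p + 1)) (/ INR (p + 1) * 0 ^ (p + 1))).
    + apply (is_RInt_derive (fun t => / INR (p + 1) * t ^ (p + 1))).
      * intros t _; auto_derive; auto.
        replace (pred (p + 1)) with p by lia; field; auto.
      * intros t _; apply (@ex_derive_continuous R_AbsRing R_NormedModule); auto_derive; auto.
    + unfold minus, plus, opp; simpl; rewrite pow_i by lia; ring.
  - refine (eq_ind _ (fun v : R => is_RInt _ 0 r v) (@is_RInt_const R_NormedModule 0 r 0) 0 _).
    unfold scal; simpl; unfold mult; simpl; ring.
Qed.

Lemma norm_C_R (z : C) : norm (V := C_R_NormedModule) z = Cmod z.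
Proof.
  unfold norm; simpl; unfold prod_norm, Cmod; f_equal; unfold norm; simpl; unfold abs; simpl.
  rewrite !Rmult_1_r; f_equal; rewrite <- Rabs_mult; apply Rabs_pos_eq, Rle_0_sqr.
Qed.

(** The integral over [0, a] is at most a M and disappears as a tends to 0, so the ordinary integral
    of a bounded function is also the improper one. *)
Lemma is_RInt_gen_bounded (g : R -> C) (r M : R) (I : C) : 0 < r ->
  (forall t, 0 <= t <= r -> Cmod (g t) <= M) ->
  is_RInt (V := C_R_NormedModule) g 0 r I ->
  is_RInt_gen (V := C_R_NormedModule) g (at_right 0) (at_point r) I.
Proof.
  intros Hr Hg HI S [eps HS].
  assert (HM : 0 <= M) by (eapply Rle_trans; [apply Cmod_ge_0|apply (Hg 0); lra]).
  set (d := Rmin r (eps / (M + 1))).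
  assert (Hd : 0 < d) by (apply Rmin_pos; [auto|apply Rdiv_lt_0_compat; [apply cond_pos|lra]]).
  apply Filter_prod with (fun t => 0 < t < d) (fun t => t = r).
  - exists (mkposreal d Hd); intros y Hy Hy0; split; auto.
    apply Rabs_def2 in Hy; unfold minus, plus, opp in Hy; simpl in Hy; lra.
  - reflexivity.
  - intros a b Ha ->; simpl.
    assert (Har : a < r) by (apply Rlt_le_trans with d; [lra|apply Rmin_l]).
    destruct (@ex_RInt_Chasles_1 C_R_CompleteNormedModule g 0 a r ltac:(lra) (ex_intro _ I HI))
      as [J HJ].
    exists (plus (opp J) I); split.
    + apply (@is_RInt_Chasles C_R_NormedModule) with 0; auto.
      apply (@is_RInt_swap C_R_NormedModule); auto.
    + apply HS, C_NormedModule_mixin_compat1.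
      apply Rle_lt_trans with (Cmod J).
      { right; rewrite <- (Cmod_opp J); apply (f_equal Cmod).
        destruct J as [J1 J2], I as [I1 I2].
        unfold minus, plus, opp; simpl; unfold prod_plus, prod_opp, plus, opp, Copp; simpl.
        apply injective_projections; simpl; ring. }
      assert (HJM : Cmod J <= (a - 0) * M).
      { rewrite <- norm_C_R.
        apply (@norm_RInt_le_const C_R_NormedModule g 0 a J M); auto; [lra|].
        intros t Ht; rewrite norm_C_R; apply Hg; lra. }
      eapply Rle_lt_trans; [exact HJM|].
      assert (Ha2 : a < eps / (M + 1)) by (apply Rlt_le_trans with d; [lra|apply Rmin_r]).
      apply Rmult_lt_compat_r with (r := M + 1) in Ha2; [|lra].
      replace (eps / (M + 1) * (M + 1)) with (pos eps) in Ha2 by (field; lra).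
      apply Rle_lt_trans with (2 := Ha2); rewrite Rminus_0_r.
      apply Rmult_le_compat_l; lra.
Qed.

(** * The matrix of the integral operator *)

(* The double power series of the integral of [vC l t * vC m t] over [0, z]. *)
Definition besselM (l m : nat) (z : C) : C :=
  Csum (fun k => Csum (fun k' =>
    RtoC (bessel_coeff l k * bessel_coeff m k' * / INR ((2 * k + l) + (2 * k' + m) + 1))
    * z ^ ((2 * k + l) + (2 * k' + m) + 1))%C).

Section BesselMatrix.
Variables (rho : R) (V : nat -> R).
Hypothesis rho_pos : 0 <= rho.
Hypothesis HV : forall l, bnd (fun k => Rabs (bessel_coeff l k) * rho ^ (2 * k + l)) (V l).

Let term (l k : nat) : R := Rabs (bessel_coeff l k) * rho ^ (2 * k + l).

Let term_pos (l k : nat) : 0 <= term l k.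
Proof. apply Rmult_le_pos; [apply Rabs_pos|apply pow_le; auto]. Qed.

Let V_pos (l : nat) : 0 <= V l := bnd_pos _ _ (HV l).

Lemma vC_term_le (l k : nat) (z : C) : Cmod z <= rho ->
  Cmod (RtoC (bessel_coeff l k) * z ^ (2 * k + l))%C <= term l k.
Proof.
  intros Hz; rewrite Cmod_mult, Cmod_R, Cmod_pow; apply Rmult_le_compat_l; [apply Rabs_pos|].
  apply pow_incr; split; [apply Cmod_ge_0|auto].
Qed.

Lemma vC_absum (l : nat) (z : C) : Cmod z <= rho ->
  absum (fun k => RtoC (bessel_coeff l k) * z ^ (2 * k + l))%C (V l).
Proof. intros Hz; apply absum_dom with (1 := HV l); intros; apply vC_term_le; auto. Qed.

Lemma vC_bound (l : nat) (z : C) : Cmod z <= rho -> Cmod (vC l z) <= V l.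
Proof. intros Hz; apply Cmod_Csum, vC_absum; auto. Qed.

(** The power has one factor [rho] more than the two terms together, and the divisor that comes from
    integration is at least 1. *)
Lemma besselM_coeff_le (l m k k' : nat) :
  Rabs (bessel_coeff l k * bessel_coeff m k' * / INR ((2 * k + l) + (2 * k' + m) + 1))
    * rho ^ ((2 * k + l) + (2 * k' + m) + 1) <= rho * term l k * term m k'.
Proof.
  set (p := ((2 * k + l) + (2 * k' + m))%nat).
  assert (Hp : 1 <= INR (p + 1)) by (apply (le_INR 1); lia).
  rewrite !Rabs_mult, (Rabs_pos_eq (/ _)) by (left; apply Rinv_0_lt_compat; lra).
  assert (Hi : / INR (p + 1) <= 1) by (rewrite <- Rinv_1; apply Rinv_le_contravar; lra).
  replace (rho * term l k * term m k') with
    (Rabs (bessel_coeff l k) * Rabs (bessel_coeff m k') * 1 * rho ^ (p + 1)).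
  - apply Rmult_le_compat_r; [apply pow_le; auto|].
    apply Rmult_le_compat_l; [apply Rmult_le_pos; apply Rabs_pos|auto].
  - unfold term, p; rewrite !pow_add; ring.
Qed.

Lemma besselM_row_bnd (l m : nat) : bnd (fun k => rho * term l k * V m) (rho * V l * V m).
Proof.
  apply bnd_dom with (fun k => rho * V m * term l k); [|intros; lra].
  replace (rho * V l * V m) with (rho * V m * V l) by ring.
  apply bnd_scal; [apply Rmult_le_pos; auto|apply HV].
Qed.

Lemma besselM_ana (l m : nat) (z0 : C) (d : R) : 0 <= d -> Cmod z0 + d = rho ->
  ana z0 d (besselM l m) (rho * V l * V m).
Proof.
  intros Hd E; apply ana_sum with (3 := besselM_row_bnd l m); auto; intros k.
  apply ana_sum with (fun k' => rho * term l k * term m k'); auto.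
  - intros k'; eapply ana_le; [apply ana_scal; auto; apply ana_pow; auto|].
    rewrite Cmod_R, E; apply besselM_coeff_le.
  - apply bnd_scal; [apply Rmult_le_pos; auto|apply HV].
Qed.

(** One factor is expanded at a time, which gives two nested termwise integrations ending in
    monomials; the endpoint is the radius for which the majorants hold. *)
Lemma is_RInt_vC_mult (l m : nat) :
  is_RInt (V := C_R_NormedModule) (fun t => (vC l (RtoC t) * vC m (RtoC t))%C) 0 rho
    (besselM l m (RtoC rho)).
Proof.
  assert (Hmod : forall t, 0 <= t <= rho -> Cmod (RtoC t) <= rho)
    by (intros t Ht; rewrite Cmod_R, Rabs_pos_eq; lra).
  assert (Hrow : forall k z, Cmod z <= rho -> absum (fun k' =>
    RtoC (bessel_coeff l k * bessel_coeff m k' * / INR ((2 * k + l) + (2 * k' + m) + 1))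
    * z ^ ((2 * k + l) + (2 * k' + m) + 1))%C (rho * term l k * V m)).
  { intros k z Hz; apply absum_dom with (fun k' => rho * term l k * term m k').
    - apply bnd_scal; [apply Rmult_le_pos; auto|apply HV].
    - intros k'; eapply Rle_trans; [|apply besselM_coeff_le].
      rewrite Cmod_mult, Cmod_R, Cmod_pow; apply Rmult_le_compat_l; [apply Rabs_pos|].
      apply pow_incr; split; [apply Cmod_ge_0|auto]. }
  assert (Hrho : Cmod (RtoC rho) <= rho) by (apply Hmod; lra).
  apply is_RInt_ext with (fun t => Csum (fun k =>
    (RtoC (bessel_coeff l k) * RtoC t ^ (2 * k + l) * vC m (RtoC t))%C)).
  { intros t; rewrite Rmin_left, Rmax_right by lra; intros Ht.
    rewrite (Csum_ext _ (fun k => vC m (RtoC t) *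
      (RtoC (bessel_coeff l k) * RtoC t ^ (2 * k + l)))%C) by (intros; ring).
    rewrite (Csum_scal _ _ (V l)); [apply Cmult_comm|apply vC_absum, Hmod; lra]. }
  apply is_RInt_Csum with (fun k => V m * term l k) (V m * V l) (rho * V l * V m); auto.
  - intros k t Ht; rewrite Cmod_mult, Rmult_comm; apply Rmult_le_compat; try apply Cmod_ge_0.
    + apply vC_bound; auto.
    + apply vC_term_le; auto.
  - apply bnd_scal; auto; apply HV.
  - intros k.
    apply is_RInt_ext with (fun t => Csum (fun k' =>
      (RtoC (bessel_coeff l k) * RtoC t ^ (2 * k + l)) *
      (RtoC (bessel_coeff m k') * RtoC t ^ (2 * k' + m)))%C).
    { intros t; rewrite Rmin_left, Rmax_right by lra; intros Ht.
      apply Csum_scal with (V m), vC_absum, Hmod; lra. }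
    apply is_RInt_Csum with (fun k' => term l k * term m k') (term l k * V m)
      (rho * term l k * V m); auto.
    + intros k' t Ht; rewrite Cmod_mult; apply Rmult_le_compat; try apply Cmod_ge_0;
        apply vC_term_le; auto.
    + apply bnd_scal; auto; apply HV.
    + intros k'.
      assert (HJ : is_RInt (V := C_R_NormedModule)
        (fun t => RtoC (bessel_coeff l k) * RtoC t ^ (2 * k + l) *
          (RtoC (bessel_coeff m k') * RtoC t ^ (2 * k' + m)))%C 0 rho
        (RtoC (bessel_coeff l k) * RtoC (bessel_coeff m k') *
          (RtoC (/ INR ((2 * k + l) + (2 * k' + m) + 1)) *
            RtoC rho ^ ((2 * k + l) + (2 * k' + m) + 1)))%C).
      { apply is_RInt_ext with (fun t => RtoC (bessel_coeff l k) * RtoC (bessel_coeff m k') *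
          RtoC t ^ ((2 * k + l) + (2 * k' + m)))%C.
        - intros t _; lazymatch goal with |- @eq _ ?x ?y => change (@eq C x y) end.
          rewrite Cpow_add_r; ring.
        - apply is_RInt_Cmult, is_RInt_Cpow. }
      refine (eq_ind _ (fun v : C => is_RInt (V := C_R_NormedModule) _ 0 rho v) HJ _ _).
      lazymatch goal with |- @eq _ ?x ?y => change (@eq C x y) end.
      rewrite !RtoC_mult; ring.
  - apply absum_dom with (1 := besselM_row_bnd l m); intros k; apply Cmod_Csum, Hrow; auto.
Qed.

End BesselMatrix.

(** * The linear system behind the integral equation *)

Section Operator.
Variables (c : nat -> C) (c0 q : R).
Hypothesis q_range : 0 < q <= 1.
Hypothesis Hc : forall l, Cmod (c l) * q ^ l <= c0 * (/ 2) ^ l.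

Let c0_pos : 0 <= c0.
Proof. pose proof (Hc O) as H; simpl in H; pose proof (Cmod_ge_0 (c O)); lra. Qed.

Definition opA (l m : nat) (z : C) : C := (c m * besselM l m z)%C.

(** The decay q^m of u_m and v_m absorbs the growth of c_m and leaves a geometric series of ratio
    1/2. *)
Lemma coeff_bnd (X : R) : 0 <= X -> bnd (fun m => Cmod (c m) * (X * q ^ m)) (2 * c0 * X).
Proof.
  intros HX; apply bnd_dom with (fun m => c0 * X * (/ 2) ^ m).
  - replace (2 * c0 * X) with (c0 * X * 2) by ring.
    apply bnd_scal; [apply Rmult_le_pos; auto|apply bnd_geom].
  - intros m; specialize (Hc m).
    replace (Cmod (c m) * _) with (X * (Cmod (c m) * q ^ m)) by ring.
    replace (c0 * X * _) with (X * (c0 * (/ 2) ^ m)) by ring.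
    apply Rmult_le_compat_l; auto.
Qed.

Lemma pow_q_le (l : nat) : q ^ l <= 1.
Proof. rewrite <- (pow1 l); apply pow_incr; lra. Qed.

Lemma pow_q_pos (l : nat) : 0 <= q ^ l.
Proof. apply pow_le; lra. Qed.

(** The decay in the row index is thrown away: the Fredholm theorem asks for a summable bound that
    depends on the column only. *)
Lemma opA_ana (z0 : C) : exists (b : nat -> R) (B : R),
  bnd b B /\ forall l m, ana z0 1 (opA l m) (b m).
Proof.
  set (rho := Cmod z0 + 1).
  assert (Hrho : 0 <= rho) by (pose proof (Cmod_ge_0 z0); unfold rho; lra).
  destruct (bessel_coeff_bnd rho q Hrho) as (X & HX & HV); [lra|].
  exists (fun m => rho * X * (Cmod (c m) * (X * q ^ m))), (rho * X * (2 * c0 * X)); split.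
  - apply bnd_scal; [apply Rmult_le_pos; auto|apply coeff_bnd; auto].
  - intros l m; eapply ana_le; [apply ana_scal|].
    + apply (besselM_ana rho (fun l => X * q ^ l)); auto; lra.
    + simpl.
      replace (Cmod (c m) * (rho * (X * q ^ l) * (X * q ^ m)))
        with (q ^ l * (rho * X * (Cmod (c m) * (X * q ^ m)))) by ring.
      rewrite <- Rmult_1_l; apply Rmult_le_compat_r; [|apply pow_q_le].
      repeat apply Rmult_le_pos; auto; [apply Cmod_ge_0|apply pow_q_pos].
Qed.

Lemma uC_ana (z0 : C) : exists X, 0 <= X /\ forall l, ana z0 1 (uC l) (X * q ^ l).
Proof.
  set (rho := Cmod z0 + 1).
  assert (Hrho : 0 <= rho) by (pose proof (Cmod_ge_0 z0); unfold rho; lra).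
  destruct (bessel_coeff_bnd rho q Hrho) as (X & HX & HV); [lra|].
  exists (rho * X); split; [apply Rmult_le_pos; auto|].
  intros l; rewrite Rmult_assoc; apply ana_mult; [lra|apply ana_id; lra|].
  apply vC_ana; [lra|apply HV].
Qed.

Lemma uC_bound (z : C) : exists X, 0 <= X /\ forall l, Cmod (uC l z) <= X * q ^ l.
Proof.
  destruct (uC_ana z) as (X & HX & H); exists X; split; auto; intros l.
  replace z with (z + 0)%C at 1 by ring.
  apply (ana_bound z 1); [auto|rewrite Cmod_0; lra].
Qed.

Lemma opA_row (z : C) : exists B, forall l, absum (fun m => opA l m z) B.
Proof.
  destruct (opA_ana z) as (b & B & Hb & H); exists B; intros l.
  apply absum_dom with (1 := Hb); intros m.
  replace z with (z + 0)%C at 1 by ring.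
  apply (ana_bound z 1); [auto|rewrite Cmod_0; lra].
Qed.

Lemma opA_solution_unique (z : C) (g x y : nat -> C) : injective_at opA z ->
  bounded_seq x -> bounded_seq y ->
  (forall l, (x l + Csum (fun m => opA l m z * x m) = g l)%C) ->
  (forall l, (y l + Csum (fun m => opA l m z * y m) = g l)%C) ->
  forall l, x l = y l.
Proof.
  intros Hinj Hx Hy Ex Ey.
  enough (H : forall l, (x l - y l)%C = 0)
    by (intros l; replace (x l) with (x l - y l + y l)%C by ring; rewrite H; ring).
  apply Hinj; [apply bounded_minus; auto|].
  intros l; destruct Hx as [X HX], Hy as [Y HY], (opA_row z) as [B HB].
  rewrite (Csum_ext _ (fun m => opA l m z * x m + - (1) * (opA l m z * y m))%C)
    by (intros; ring).
  erewrite Csum_plus, Csum_scal;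
    [|apply absum_scal_bounded with (1 := HY), HB
     |apply absum_scal_bounded with (1 := HX), HB
     |apply absum_scal, absum_scal_bounded with (1 := HY), HB].
  transitivity ((x l + Csum (fun m => opA l m z * x m)) -
    (y l + Csum (fun m => opA l m z * y m)))%C; [ring|rewrite Ex, Ey; ring].
Qed.

Section Kernel.
Variable a : nat -> C.
Variable beta : R.
Hypothesis Ha : forall l, Cmod (a l) <= beta.

Let beta_pos : 0 <= beta.
Proof. eapply Rle_trans; [apply Cmod_ge_0|apply (Ha O)]. Qed.

(** The ansatz for K at a fixed first argument z, with [a] standing for the sequence a_l(z). *)
Definition kernelC (w : C) : C := Csum (fun l => c l * a l * uC l w)%C.

Lemma kernel_term_le (l : nat) (x : C) (X : R) : Cmod x <= X * q ^ l ->
  Cmod (c l * a l * x) <= beta * (Cmod (c l) * (X * q ^ l)).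
Proof.
  intros Hx; rewrite !Cmod_mult.
  replace (beta * (Cmod (c l) * (X * q ^ l))) with (Cmod (c l) * beta * (X * q ^ l)) by ring.
  apply Rmult_le_compat; try apply Cmod_ge_0; auto.
  - apply Rmult_le_pos; apply Cmod_ge_0.
  - apply Rmult_le_compat_l; [apply Cmod_ge_0|auto].
Qed.

Lemma kernelC_ana (w0 : C) : exists M, ana w0 1 kernelC M.
Proof.
  destruct (uC_ana w0) as (X & HX & HU).
  exists (beta * (2 * c0 * X)).
  apply ana_sum with (fun l => beta * (Cmod (c l) * (X * q ^ l))); [lra| |].
  - intros l; apply ana_le with (Cmod (c l * a l) * (X * q ^ l)).
    + apply ana_scal; auto.
    + rewrite Cmod_mult.
      replace (beta * (Cmod (c l) * (X * q ^ l))) with (Cmod (c l) * beta * (X * q ^ l)) by ring.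
      apply Rmult_le_compat_r; [apply Rmult_le_pos; [auto|apply pow_q_pos]|].
      apply Rmult_le_compat_l; [apply Cmod_ge_0|auto].
  - apply bnd_scal; auto; apply coeff_bnd; auto.
Qed.

(** A Taylor disc of radius 1 about each point s gives |k(t) - k(s)| <= |t - s| M, by
    [ana_increment]. *)
Lemma kernelC_continuous (r : R) :
  continuous_on (fun s : R => 0 <= s <= r) (fun s => kernelC (RtoC s)).
Proof.
  intros s _; apply filterlim_locally; intros eps.
  destruct (kernelC_ana (RtoC s)) as [M HM].
  assert (HM0 : 0 <= M) by (apply ana_pos with (1 := HM)).
  set (d := Rmin 1 (eps / (M + 1))).
  assert (Hd : 0 < d) by (apply Rmin_pos; [lra|apply Rdiv_lt_0_compat; [apply cond_pos|lra]]).
  exists (mkposreal d Hd); intros t Ht _; apply C_NormedModule_mixin_compat1.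
  change (Rabs (t - s) < d) in Ht.
  assert (Hinc := ana_increment (RtoC s) 1 Rle_0_1 (Rabs (t - s)) kernelC M).
  pose proof (Rabs_pos (t - s)).
  assert (Ht1 : Rabs (t - s) < 1) by (apply Rlt_le_trans with d; [lra|apply Rmin_l]).
  assert (Ht2 : Rabs (t - s) < eps / (M + 1)) by (apply Rlt_le_trans with d; [lra|apply Rmin_r]).
  specialize (Hinc ltac:(lra) ltac:(lra) HM).
  apply (ana_bound _ _ ) with (h := RtoC (t - s)) in Hinc; [|rewrite Cmod_R; lra].
  replace (RtoC s + RtoC (t - s))%C with (RtoC t) in Hinc by (rewrite RtoC_minus; ring).
  eapply Rle_lt_trans; [exact Hinc|].
  apply Rmult_lt_compat_r with (r := M + 1) in Ht2; [|lra].
  replace (eps / (M + 1) * (M + 1)) with (pos eps) in Ht2 by (field; lra).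
  unfold Rdiv; rewrite Rinv_1, Rmult_1_r.
  apply Rle_lt_trans with (2 := Ht2); apply Rmult_le_compat_l; lra.
Qed.

Lemma kernelC_0 : kernelC 0 = 0.
Proof.
  unfold kernelC; rewrite (Csum_ext _ (fun _ => RtoC 0)); [apply Csum_0|].
  intros l; unfold uC; ring.
Qed.

Section Integrals.
Variable r : R.
Hypothesis r_pos : 0 < r.

(* [kernelC t / t] *)
Let p (t : R) : C := Csum (fun m => c m * a m * vC m (RtoC t))%C.

(** Termwise integration of k(t)/t against v_l produces the coordinate l of A a. The bound and the
    factor t are recorded with it because they dispose of the singular weight. *)
Lemma kernelC_integrals : exists M : R,
  (forall t, 0 <= t <= r -> Cmod (p t) <= M) /\
  (forall t, 0 <= t <= r -> kernelC (RtoC t) = (RtoC t * p t)%C) /\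
  forall l, is_RInt (V := C_R_NormedModule) (fun t => p t * vC l (RtoC t))%C 0 r
    (Csum (fun m => opA l m (RtoC r) * a m))%C.
Proof.
  destruct (bessel_coeff_bnd r q) as (X & HX & HV); [lra|lra|].
  assert (Hmod : forall t, 0 <= t <= r -> Cmod (RtoC t) <= r)
    by (intros t Ht; rewrite Cmod_R, Rabs_pos_eq; lra).
  assert (Hv : forall l t, 0 <= t <= r -> Cmod (vC l (RtoC t)) <= X * q ^ l)
    by (intros l t Ht; apply (vC_bound r (fun l => X * q ^ l)); auto; lra).
  assert (Hb : bnd (fun m => beta * (Cmod (c m) * (X * q ^ m))) (beta * (2 * c0 * X)))
    by (apply bnd_scal; auto; apply coeff_bnd; auto).
  assert (Hp : forall t, 0 <= t <= r ->
    absum (fun m => c m * a m * vC m (RtoC t))%C (beta * (2 * c0 * X))).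
  { intros t Ht; apply absum_dom with (1 := Hb); intros m; apply kernel_term_le; auto. }
  destruct (opA_row (RtoC r)) as [BA HBA].
  exists (beta * (2 * c0 * X)); split; [|split].
  - intros t Ht; apply Cmod_Csum; auto.
  - intros t Ht; unfold p; rewrite <- (Csum_scal _ _ _ (Hp t Ht)).
    apply Csum_ext; intros; unfold uC; ring.
  - intros l.
    apply is_RInt_ext with (fun t => Csum (fun m =>
      (c m * a m * (vC l (RtoC t) * vC m (RtoC t)))%C)).
    { intros t; rewrite Rmin_left, Rmax_right by lra; intros Ht.
      rewrite (Csum_ext _ (fun m => vC l (RtoC t) * (c m * a m * vC m (RtoC t)))%C)
        by (intros; ring).
      rewrite (Csum_scal _ _ _ (Hp t ltac:(lra))); apply Cmult_comm. }
    apply is_RInt_Csum with (fun m => X * q ^ l * (beta * (Cmod (c m) * (X * q ^ m))))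
      (X * q ^ l * (beta * (2 * c0 * X))) (beta * BA).
    + lra.
    + intros m t Ht.
      replace (c m * a m * _)%C with (vC l (RtoC t) * (c m * a m * vC m (RtoC t)))%C by ring.
      rewrite Cmod_mult; apply Rmult_le_compat; try apply Cmod_ge_0; auto.
      apply kernel_term_le; auto.
    + apply bnd_scal; auto; apply Rmult_le_pos; [auto|apply pow_q_pos].
    + intros m; unfold opA.
      replace (c m * besselM l m r * a m)%C with (c m * a m * besselM l m r)%C by ring.
      apply is_RInt_Cmult, is_RInt_vC_mult with (fun l => X * q ^ l); auto; lra.
    + apply absum_scal_bounded with (1 := Ha), HBA.
Qed.

(** The factors t of k(t) and of f(t,s) cancel t^-2. What is left is bounded, so the integral is a
    proper one and the series of f is integrated termwise. *)
Lemma kernelC_integral (s : R) : 0 <= s <= r ->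
  is_RInt_gen (V := C_R_NormedModule)
    (fun t : R => (kernelC (RtoC t) * Defs.f c t s * RtoC (/ t ^ 2))%C)
    (at_right 0) (at_point r)
    (Csum (fun l => c l * uC l (RtoC s) * Csum (fun m => opA l m (RtoC r) * a m)))%C.
Proof.
  intros Hs.
  destruct kernelC_integrals as (M & HM & Hk & HI).
  destruct (bessel_coeff_bnd r q) as (X & HX & HV); [lra|lra|].
  assert (Hmod : forall t, 0 <= t <= r -> Cmod (RtoC t) <= r)
    by (intros t Ht; rewrite Cmod_R, Rabs_pos_eq; lra).
  assert (Hv : forall l t, 0 <= t <= r -> Cmod (vC l (RtoC t)) <= X * q ^ l)
    by (intros l t Ht; apply (vC_bound r (fun l => X * q ^ l)); auto; lra).
  assert (HM0 : 0 <= M) by (eapply Rle_trans; [apply Cmod_ge_0|apply (HM 0); lra]).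
  destruct (uC_bound (RtoC s)) as (Y & HY & HU).
  assert (HU1 : forall l, Cmod (uC l (RtoC s)) <= Y).
  { intros l; eapply Rle_trans; [apply HU|].
    rewrite <- (Rmult_1_r Y) at 2; apply Rmult_le_compat_l; [auto|apply pow_q_le]. }
  assert (Hb : bnd (fun l => M * Y * (Cmod (c l) * (X * q ^ l))) (M * Y * (2 * c0 * X)))
    by (apply bnd_scal; [apply Rmult_le_pos; auto|apply coeff_bnd; auto]).
  assert (Hsum : forall l t, 0 <= t <= r ->
    Cmod (c l * uC l (RtoC s) * (p t * vC l (RtoC t))) <=
    M * Y * (Cmod (c l) * (X * q ^ l))).
  { intros l t Ht; rewrite !Cmod_mult.
    replace (M * Y * _) with (Cmod (c l) * Y * (M * (X * q ^ l))) by ring.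
    apply Rmult_le_compat.
    - apply Rmult_le_pos; apply Cmod_ge_0.
    - apply Rmult_le_pos; apply Cmod_ge_0.
    - apply Rmult_le_compat_l; [apply Cmod_ge_0|auto].
    - apply Rmult_le_compat; try apply Cmod_ge_0; auto. }
  destruct (opA_row (RtoC r)) as [BA HBA].
  set (W t := Csum (fun l => c l * uC l (RtoC s) * (p t * vC l (RtoC t)))%C).
  assert (HfW : forall t, 0 < t < r ->
    W t = (kernelC (RtoC t) * Defs.f c t s * RtoC (/ t ^ 2))%C).
  { intros t Ht.
    assert (Hs1 : absum (fun l => c l * uC l (RtoC s) * vC l (RtoC t))%C (Y * (2 * c0 * X))).
    { apply absum_dom with (fun l => Y * (Cmod (c l) * (X * q ^ l))).
      - apply bnd_scal; [auto|apply coeff_bnd; auto].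
      - intros l; rewrite !Cmod_mult.
        replace (Y * _) with (Cmod (c l) * Y * (X * q ^ l)) by ring.
        apply Rmult_le_compat; try apply Cmod_ge_0.
        + apply Rmult_le_pos; apply Cmod_ge_0.
        + apply Rmult_le_compat_l; [apply Cmod_ge_0|auto].
        + apply Hv; lra. }
    rewrite Hk, f_Csum by lra.
    rewrite (Csum_ext (fun l => c l * uC l (RtoC t) * uC l (RtoC s))%C
      (fun l => RtoC t * (c l * uC l (RtoC s) * vC l (RtoC t)))%C)
      by (intros; unfold uC; ring).
    rewrite (Csum_scal _ _ _ Hs1); unfold W.
    rewrite (Csum_ext _ (fun l => p t * (c l * uC l (RtoC s) * vC l (RtoC t)))%C)
      by (intros; ring).
    rewrite (Csum_scal _ _ _ Hs1), RtoC_inv, RtoC_pow by (apply pow_nonzero; lra).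
    field; intros E; injection E; lra. }
  apply is_RInt_gen_ext with W.
  { apply Filter_prod with (fun t => 0 < t < r) (fun t => t = r).
    - exists (mkposreal r r_pos); intros y Hy Hy0; split; auto.
      apply Rabs_def2 in Hy; unfold minus, plus, opp in Hy; simpl in Hy; lra.
    - reflexivity.
    - intros x y Hx ->; simpl; intros t Ht.
      rewrite Rmin_left, Rmax_right in Ht by lra; apply HfW; lra. }
  apply is_RInt_gen_bounded with (M * Y * (2 * c0 * X)); auto.
  - intros t Ht; apply Cmod_Csum, absum_dom with (1 := Hb); auto.
  - apply is_RInt_Csum with (fun l => M * Y * (Cmod (c l) * (X * q ^ l)))
      (M * Y * (2 * c0 * X)) (beta * BA * (2 * c0 * Y)); auto; [lra| |].
    + intros l; apply is_RInt_Cmult; auto.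
    + apply absum_scal_bounded; [intros l; apply Cmod_Csum, absum_scal_bounded; auto|].
      apply absum_dom with (1 := coeff_bnd Y HY); intros l.
      rewrite Cmod_mult; apply Rmult_le_compat_l; [apply Cmod_ge_0|auto].
Qed.
End Integrals.
End Kernel.
End Operator.

(** * Analyticity in two variables *)

(** Any bound sharpens to the sum itself; written as the modulus of a [Csum], it can be summed once
    more by [absum_Csum]. *)
Lemma bnd_Csum_RtoC (x : nat -> R) (B : R) : (forall k, 0 <= x k) -> bnd x B ->
  bnd x (Cmod (Csum (fun k => RtoC (x k)))).
Proof.
  intros Hx H n; rewrite Csum_RtoC, Cmod_R.
  eapply Rle_trans; [|apply Rle_abs].
  apply rsum_le_Series; auto; apply bnd_ex_series with B; auto.
Qed.

(** [sum_n] includes the index n whereas [csum] stops before it, a shift that does not affect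
    limits. *)
Lemma is_double_series_csum (x : nat -> nat -> C) (v : C) (M : R) :
  (forall n, rsum (fun i => rsum (fun j => Cmod (x i j)) n) n <= M) ->
  Cconv (fun n => csum (fun i => csum (x i) n) n) v -> is_double_series x v.
Proof.
  intros HM Hv; split.
  - exists M; intros n; rewrite rsum_sum_n; eapply Rle_trans; [|apply (HM (S n))].
    apply Req_le, rsum_ext; intros i _; apply rsum_sum_n.
  - apply filterlim_ext with (fun n => csum (fun i => csum (x i) (S n)) (S n)).
    + intros n; rewrite csum_sum_n; apply csum_ext; intros i _; symmetry; apply csum_sum_n.
    + apply filterlim_of_Cconv.
      exact (proj1 (is_lim_seq_incr_1 (fun n => Cmod (csum (fun i => csum (x i) n) n - v)) 0) Hv).
Qed.

(** The coefficients are the sums over l of d_l p_li q_lj. For each l the square partial sums factor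
    into partial sums of the series of [F l] and [G l], and Tannery's theorem in l gives the
    limit. *)
Lemma analytic2_at_Csum (d : nat -> C) (F G : nat -> C -> C) (z0 w0 : C)
    (rho beta S : R) (gamma : nat -> R) : 0 < rho ->
  (forall l, ana z0 rho (F l) beta) -> (forall l, ana w0 rho (G l) (gamma l)) ->
  bnd (fun l => Cmod (d l) * gamma l) S ->
  analytic2_at (fun z w => Csum (fun l => d l * F l z * G l w)%C) z0 w0.
Proof.
  intros Hrho HF HG HS.
  set (p l := proj1_sig (constructive_indefinite_description _ (HF l))).
  assert (Hp : forall l, bnd (fun i => Cmod (p l i) * rho ^ i) beta /\
    forall h, Cmod h <= rho -> F l (z0 + h)%C = Csum (fun i => (p l i * h ^ i)%C))
    by (intros l; exact (proj2_sig (constructive_indefinite_description _ (HF l)))).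
  set (q l := proj1_sig (constructive_indefinite_description _ (HG l))).
  assert (Hq : forall l, bnd (fun j => Cmod (q l j) * rho ^ j) (gamma l) /\
    forall h, Cmod h <= rho -> G l (w0 + h)%C = Csum (fun j => (q l j * h ^ j)%C))
    by (intros l; exact (proj2_sig (constructive_indefinite_description _ (HG l)))).
  clearbody p q.
  assert (beta_pos : 0 <= beta) by exact (bnd_pos _ _ (proj1 (Hp O))).
  assert (gamma_pos : forall l, 0 <= gamma l) by (intros l; exact (bnd_pos _ _ (proj1 (Hq l)))).
  assert (dg_pos : forall l, 0 <= Cmod (d l) * gamma l)
    by (intros l; apply Rmult_le_pos; [apply Cmod_ge_0|auto]).
  exists (fun i j => Csum (fun l => d l * p l i * q l j)%C), rho; split; auto.
  intros z w Hz Hw.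
  set (h := (z - z0)%C) in *; set (g := (w - w0)%C) in *.
  replace z with (z0 + h)%C by (unfold h; ring); replace w with (w0 + g)%C by (unfold g; ring).
  clearbody h g; clear z w.
  assert (Hp1 : forall l, absum (fun i => p l i * h ^ i)%C beta)
    by (intros l; apply absum_power with rho; [apply Hp|lra]).
  assert (Hq1 : forall l, absum (fun j => q l j * g ^ j)%C (gamma l))
    by (intros l; apply absum_power with rho; [apply Hq|lra]).
  set (x l i j := (d l * (p l i * h ^ i) * (q l j * g ^ j))%C).
  (* Bounds the sum over [j] of the moduli of [x l i j]; its own sum over [i] is at most
     [Cmod (d l) * gamma l * beta]. *)
  set (y i l := Cmod (d l) * gamma l * Cmod (p l i * h ^ i)).
  assert (y_pos : forall i l, 0 <= y i l)
    by (intros; apply Rmult_le_pos; [auto|apply Cmod_ge_0]).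
  assert (Hy1 : bnd (fun l => Cmod (d l) * gamma l * beta) (S * beta)).
  { intros n; rewrite (rsum_ext _ (fun l => beta * (Cmod (d l) * gamma l))) by (intros; ring).
    rewrite rsum_scal, Rmult_comm; apply Rmult_le_compat_r; auto. }
  assert (Hy2 : forall l, absum (fun i => RtoC (y i l)) (Cmod (d l) * gamma l * beta)).
  { intros l n; rewrite (rsum_ext _ (fun i => y i l)) by (intros; rewrite Cmod_R; apply Rabs_pos_eq; auto).
    apply bnd_scal; auto; apply Hp1. }
  assert (Hy3 : forall i, bnd (y i) (S * beta)).
  { intros i; apply bnd_dom with (1 := Hy1); intros l; apply Rmult_le_compat_l; auto.
    apply (bnd_term (fun i => Cmod (p l i * h ^ i))); [intros; apply Cmod_ge_0|apply Hp1]. }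
  assert (Hx : forall i l, absum (x l i) (y i l)).
  { intros i l; unfold y.
    replace (Cmod (d l) * gamma l * _) with (Cmod (d l * (p l i * h ^ i)) * gamma l)
      by (rewrite (Cmod_mult (d l)); ring).
    apply absum_scal; auto. }
  assert (Hxl : forall i j, absum (fun l => x l i j) (S * beta)).
  { intros i j; apply absum_dom with (1 := Hy3 i); intros l.
    apply (bnd_term (fun j => Cmod (x l i j))); [intros; apply Cmod_ge_0|apply Hx]. }
  assert (Hk : forall i j, (Csum (fun l => d l * p l i * q l j) * h ^ i * g ^ j)%C =
    Csum (fun l => x l i j)).
  { intros i j.
    assert (H : absum (fun l => d l * p l i * q l j)%C (beta / rho ^ i / rho ^ j * S)).
    { apply absum_dom with (fun l => beta / rho ^ i / rho ^ j * (Cmod (d l) * gamma l)).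
      - apply bnd_scal; auto.
        repeat apply Rdiv_le_0_compat; auto; apply pow_lt; auto.
      - intros l.
        assert (H1 : Cmod (p l i) <= beta / rho ^ i).
        { apply Rle_div_r; [apply pow_lt; auto|].
          apply (bnd_term (fun i => Cmod (p l i) * rho ^ i)); [|apply Hp].
          intros; apply Rmult_le_pos; [apply Cmod_ge_0|apply pow_le; lra]. }
        assert (H2 : Cmod (q l j) <= gamma l / rho ^ j).
        { apply Rle_div_r; [apply pow_lt; auto|].
          apply (bnd_term (fun j => Cmod (q l j) * rho ^ j)); [|apply Hq].
          intros; apply Rmult_le_pos; [apply Cmod_ge_0|apply pow_le; lra]. }
        rewrite !Cmod_mult.
        replace (beta / rho ^ i / rho ^ j * (Cmod (d l) * gamma l)) with (Cmod (d l) * (beta / rho ^ i) * (gamma l / rho ^ j))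
          by (unfold Rdiv; ring).
        apply Rmult_le_compat; try apply Cmod_ge_0; auto.
        + apply Rmult_le_pos; apply Cmod_ge_0.
        + apply Rmult_le_compat_l; [apply Cmod_ge_0|auto]. }
    rewrite (Csum_ext (fun l => x l i j) (fun l => h ^ i * g ^ j * (d l * p l i * q l j))%C)
      by (intros; unfold x; ring).
    rewrite (Csum_scal _ _ _ H); ring. }
  apply is_double_series_csum with (S * beta).
  - intros n.
    (* [absum_Csum] is used twice: over [j] for each fixed [i], then over [i]. *)
    apply Rle_trans with (rsum (fun i => Cmod (Csum (fun l => RtoC (y i l)))) n).
    + apply rsum_le; intros i _.
      rewrite (rsum_ext _ (fun j => Cmod (Csum (fun l => x l i j)))) by (intros; rewrite Hk; auto).
      apply (absum_Csum (fun l j => x l i j) (y i)); [auto|].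
      apply bnd_Csum_RtoC with (S * beta); auto.
    + apply (absum_Csum (fun l i => RtoC (y i l)) _ _ Hy2 Hy1).
  - apply Cconv_ext with (fun n => Csum (fun l => csum (fun i => csum (fun j => x l i j) n) n)).
    + intros n.
      assert (Hj : forall i, csum (fun j => Csum (fun l => x l i j)) n =
          Csum (fun l => csum (fun j => x l i j) n) /\
        absum (fun l => csum (fun j => x l i j) n) (rsum (fun _ => S * beta) n))
        by (intros i; apply (csum_Csum (fun j l => x l i j)); auto).
      rewrite (csum_ext (fun i => csum _ n) (fun i => Csum (fun l => csum (fun j => x l i j) n))).
      * symmetry.
        apply (fun H => proj1 (csum_Csum (fun i l => csum (fun j => x l i j) n)
          (fun _ => rsum (fun _ => S * beta) n) n H)).
        intros i _; apply Hj.
      * intros i _; rewrite <- (proj1 (Hj i)); apply csum_ext; intros j _; apply Hk.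
    + assert (Hprod : forall n l, csum (fun i => csum (fun j => x l i j) n) n =
        (d l * (csum (fun i => p l i * h ^ i) n * csum (fun j => q l j * g ^ j) n))%C).
      { intros n l.
        rewrite (csum_ext _ (fun i => d l * csum (fun j => q l j * g ^ j) n * (p l i * h ^ i))%C).
        - rewrite csum_scal; ring.
        - intros i _; unfold x; rewrite csum_scal; ring. }
      apply Csum_dominated with (1 := Hy1).
      * intros n l; rewrite Hprod, !Cmod_mult.
        replace (Cmod (d l) * gamma l * beta) with (Cmod (d l) * (beta * gamma l)) by ring.
        apply Rmult_le_compat_l; [apply Cmod_ge_0|].
        apply Rmult_le_compat; try apply Cmod_ge_0;
          (eapply Rle_trans; [apply Cmod_csum|]); [apply Hp1|apply Hq1].
      * intros l; apply Cconv_ext with (1 := fun n => eq_sym (Hprod n l)).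
        rewrite <- Cmult_assoc; apply Cconv_scal.
        rewrite (proj2 (Hp l)), (proj2 (Hq l)) by lra.
        apply Cconv_mult with beta.
        -- intros n; eapply Rle_trans; [apply Cmod_csum|apply Hp1].
        -- apply (Csum_conv _ _ (Hp1 l)).
        -- apply (Csum_conv _ _ (Hq1 l)).
Qed.

Lemma analytic2_at_ext (F G : C -> C -> C) (z0 w0 : C) (r : R) : 0 < r ->
  (forall z w, Cmod (z - z0) < r -> F z w = G z w) ->
  analytic2_at F z0 w0 -> analytic2_at G z0 w0.
Proof.
  intros Hr H (a & rho & Hrho & Ha).
  exists a, (Rmin r rho); split; [apply Rmin_pos; auto|].
  intros z w Hz Hw; rewrite <- H.
  - apply Ha; [apply Rlt_le_trans with (1 := Hz)|apply Rlt_le_trans with (1 := Hw)]; apply Rmin_r.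
  - apply Rlt_le_trans with (1 := Hz), Rmin_l.
Qed.

(** * Solutions of the integral equation *)

Section Solutions.
Variables (c : nat -> C) (c0 q : R).
Hypothesis q_range : 0 < q <= 1.
Hypothesis Hc : forall l, Cmod (c l) * q ^ l <= c0 * (/ 2) ^ l.

(** The integral is the kernel of A a, and A a = g - a. With g = u(r) this yields the integral
    equation, with g = 0 its homogeneous form. *)
Lemma kernelC_solution_integral (a g : nat -> C) (r s : R) :
  bounded_seq a -> bounded_seq g -> 0 < r -> 0 <= s <= r ->
  (forall l, (a l + Csum (fun m => opA c l m (RtoC r) * a m) = g l)%C) ->
  is_RInt_gen (V := C_R_NormedModule)
    (fun t : R => (kernelC c a (RtoC t) * Defs.f c t s * RtoC (/ t ^ 2))%C)
    (at_right 0) (at_point r) (kernelC c g (RtoC s) - kernelC c a (RtoC s))%C.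
Proof.
  intros [beta Ha] [delta Hg] Hr Hs Heq.
  assert (H := kernelC_integral c c0 q q_range Hc a beta Ha r Hr s Hs).
  replace (kernelC c g (RtoC s) - kernelC c a (RtoC s))%C with
    (Csum (fun l => c l * uC l (RtoC s) * Csum (fun m => opA c l m (RtoC r) * a m)))%C;
    [exact H|].
  destruct (uC_bound q q_range (RtoC s)) as (X & HX & HU).
  assert (Hsum : forall x B, 0 <= B -> (forall l, Cmod (x l) <= B) ->
    absum (fun l => c l * x l * uC l (RtoC s))%C (B * (2 * c0 * X))).
  { intros x B HB Hx; apply absum_dom with (fun l => B * (Cmod (c l) * (X * q ^ l))).
    - apply bnd_scal; auto; apply coeff_bnd; auto.
    - intros l; apply kernel_term_le with (a := x); auto. }
  assert (Hb1 : 0 <= beta) by (eapply Rle_trans; [apply Cmod_ge_0|apply (Ha O)]).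
  assert (Hb2 : 0 <= delta) by (eapply Rle_trans; [apply Cmod_ge_0|apply (Hg O)]).
  rewrite (Csum_ext _ (fun l => c l * g l * uC l (RtoC s) +
    - (1) * (c l * a l * uC l (RtoC s)))%C).
  - unfold kernelC.
    rewrite (Csum_plus _ _ _ _ (Hsum g delta Hb2 Hg) (absum_scal _ _ _ (Hsum a beta Hb1 Ha))).
    rewrite (Csum_scal _ _ _ (Hsum a beta Hb1 Ha)); ring.
  - intros l; rewrite <- Heq; ring.
Qed.

Lemma uC_bounded_seq (z : C) : bounded_seq (fun l => uC l z).
Proof.
  destruct (uC_bound q q_range z) as (X & HX & HU); exists X; intros l.
  eapply Rle_trans; [apply HU|].
  rewrite <- (Rmult_1_r X) at 2; apply Rmult_le_compat_l; auto.
  apply pow_q_le; auto.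
Qed.

Lemma kernelC_solves (a : nat -> C) (r : R) : bounded_seq a -> 0 < r ->
  (forall l, (a l + Csum (fun m => opA c l m (RtoC r) * a m) = uC l (RtoC r))%C) ->
  solves c r (fun s => kernelC c a (RtoC s)).
Proof.
  intros Ha Hr Heq; split; [|split].
  - destruct Ha as [beta Ha]; apply kernelC_continuous with c0 q beta; auto.
  - apply kernelC_0.
  - intros s Hs; eexists; split.
    + apply kernelC_solution_integral with (3 := Hr) (4 := Hs) (5 := Heq); auto.
      apply uC_bounded_seq.
    + rewrite f_Csum by lra; unfold kernelC; ring.
Qed.

Lemma continuous_on_Cplus (D : R -> Prop) (f g : R -> C) :
  continuous_on D f -> continuous_on D g -> continuous_on D (fun x => (f x + g x)%C).
Proof.
  intros Hf Hg x Hx.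
  eapply filterlim_comp_2; [exact (Hf x Hx)|exact (Hg x Hx)|].
  exact (filterlim_plus (V := C_R_NormedModule) (f x) (g x)).
Qed.

Lemma uniquely_solvable_injective (r : R) : 0 < r -> uniquely_solvable c r ->
  injective_at (opA c) (RtoC r).
Proof.
  intros Hr (k & (Hk1 & Hk2 & Hk3) & Huniq) x Hx Heq.
  assert (Hx' := Hx); destruct Hx' as [beta Hbeta].
  assert (Hsol : solves c r (fun s => k s + kernelC c x (RtoC s))%C).
  { split; [|split].
    - apply continuous_on_Cplus; auto.
      apply kernelC_continuous with c0 q beta; auto.
    - rewrite Hk2, kernelC_0; ring.
    - intros s Hs; destruct (Hk3 s Hs) as (I & HI & HE).
      assert (H0 := kernelC_solution_integral x (fun _ => RtoC 0) r s Hx bounded_0 Hr Hs Heq).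
      exists (I + (kernelC c (fun _ => RtoC 0) (RtoC s) - kernelC c x (RtoC s)))%C; split.
      + refine (is_RInt_gen_ext _ _ _ _ (is_RInt_gen_plus _ _ _ _ HI H0)).
        apply filter_forall; intros ab t _.
        lazymatch goal with |- @eq _ ?x ?y => change (@eq C x y) end.
        unfold plus; simpl.
        change (k t * Defs.f c t s * RtoC (/ t ^ 2) +
          kernelC c x (RtoC t) * Defs.f c t s * RtoC (/ t ^ 2) =
          (k t + kernelC c x (RtoC t)) * Defs.f c t s * RtoC (/ t ^ 2))%C; ring.
      + rewrite HE; unfold kernelC at 2.
        rewrite (Csum_ext (fun l => c l * 0 * uC l (RtoC s))%C (fun _ => RtoC 0)) by (intros; ring).
        rewrite Csum_0; ring. }
  assert (Hzero : forall s, 0 <= s <= r -> kernelC c x (RtoC s) = 0).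
  { intros s Hs; pose proof (Huniq _ Hsol s Hs) as E; simpl in E.
    replace (kernelC c x (RtoC s)) with (k s + kernelC c x (RtoC s) - k s)%C by ring.
    rewrite E; ring. }
  destruct (kernelC_integrals c c0 q q_range Hc x beta Hbeta r Hr) as (M & HM & Hp & HI).
  (* The equation makes x_l minus the integral of k(t)/t against v_l, and this integrand vanishes on
     the open interval. *)
  intros l; specialize (HI l).
  replace (x l) with (x l + Csum (fun m => opA c l m (RtoC r) * x m) -
    Csum (fun m => opA c l m (RtoC r) * x m))%C by ring.
  rewrite Heq.
  replace (Csum _) with (RtoC 0); [ring|].
  apply (@is_RInt_unique C_R_CompleteNormedModule) in HI; rewrite <- HI.
  symmetry; apply (@is_RInt_unique C_R_CompleteNormedModule).
  apply is_RInt_ext with (fun _ => RtoC 0).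
  - intros t; rewrite Rmin_left, Rmax_right by lra; intros Ht.
    assert (E := Hp t ltac:(lra)); rewrite Hzero in E by lra.
    assert (Ht0 : RtoC t <> 0) by (intros H; injection H; lra).
    lazymatch goal with |- @eq _ ?x ?y => change (@eq C x y) end.
    replace (Csum (fun m => c m * x m * vC m (RtoC t))%C) with (RtoC 0); [ring|].
    apply (f_equal (Cmult (/ RtoC t))) in E; rewrite Cmult_assoc, Cinv_l in E by auto.
    rewrite Cmult_1_l in E; rewrite <- E; ring.
  - exact (is_RInt_csum (fun _ t => RtoC t ^ 0)%C 0 r _ 0 (fun _ => is_RInt_Cpow r 0)).
Qed.

End Solutions.

(** * The domain and the extension of the kernel *)

Lemma open_of_discs (D : C -> Prop) :
  (forall z, D z -> exists rho, 0 < rho /\ forall h, Cmod h <= rho -> D (z + h)%C) -> open D.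
Proof.
  intros H z Hz; destruct (H z Hz) as (rho & Hrho & HD).
  (* Halving the radius makes up for the factor sqrt 2 between balls of the product structure and
     discs. *)
  assert (Hr2 : 0 < rho / 2) by lra.
  exists (mkposreal _ Hr2); intros y Hy.
  apply C_NormedModule_mixin_compat2 in Hy.
  change (Cmod (y - z) < sqrt 2 * (rho / 2)) in Hy.
  replace y with (z + (y - z))%C by ring; apply HD.
  assert (sqrt 2 <= 2) by (rewrite <- (sqrt_square 2) at 2 by lra; apply sqrt_le_1; lra).
  apply Rle_trans with (sqrt 2 * (rho / 2)); [lra|].
  apply Rle_trans with (2 * (rho / 2)); [apply Rmult_le_compat_r|]; lra.
Qed.

(** Take q = e^(-b)/2: the exponential cancels the growth of c_l, and the factor 1/2 leaves a
    summable remainder. *)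
Lemma exponential_bound_weight (c : nat -> C) (c0 b : R) : 0 < b ->
  (forall l, Cmod (c l) <= c0 * exp (b * INR l)) ->
  exists q, 0 < q <= 1 /\ forall l, Cmod (c l) * q ^ l <= c0 * (/ 2) ^ l.
Proof.
  intros Hb Hc; exists (exp (- b) * / 2).
  pose proof (exp_pos (- b)).
  assert (exp (- b) < 1) by (rewrite <- exp_0; apply exp_increasing; lra).
  split; [lra|]; intros l; rewrite Rpow_mult_distr.
  assert (E : exp (b * INR l) * exp (- b) ^ l = 1).
  { clear; induction l as [|l IH]; [simpl; rewrite Rmult_0_r, exp_0; ring|].
    rewrite S_INR, Rmult_plus_distr_l, exp_plus, Rmult_1_r; simpl.
    transitivity (exp (b * INR l) * exp (- b) ^ l * (exp b * exp (- b))); [ring|].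
    rewrite IH, <- exp_plus, Rplus_opp_r, exp_0; ring. }
  replace (c0 * (/ 2) ^ l) with (c0 * exp (b * INR l) * (exp (- b) ^ l * (/ 2) ^ l)).
  - apply Rmult_le_compat_r; auto.
    apply Rmult_le_pos; apply pow_le; lra.
  - transitivity (c0 * (exp (b * INR l) * exp (- b) ^ l) * (/ 2) ^ l); [ring|].
    rewrite E; ring.
Qed.

Theorem mainTheorem16 (c : nat -> C) (K : R -> R -> C)
  (hc : exists c0 b : R, 0 < c0 /\ 0 < b /\
          forall l : nat, Cmod (c l) <= c0 * exp (b * INR l))
  (huniq : forall r : R, 0 < r -> uniquely_solvable c r)
  (hK : forall r : R, 0 < r -> solves c r (K r)) :
  exists (Delta : C -> Prop) (Kext : C -> C -> C),
    open Delta /\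
    (forall r : R, 0 < r -> Delta (RtoC r)) /\
    (forall z w : C, Delta z -> Delta w -> analytic2_at Kext z w) /\
    (forall r s : R, 0 < s <= r -> Kext (RtoC r) (RtoC s) = K r s).
Proof.
  destruct hc as (c0 & b & _ & Hb & Hc0).
  destruct (exponential_bound_weight c c0 b Hb Hc0) as (q & q_range & Hc).
  set (is_sol z a := bounded_seq a /\
    forall l, (a l + Csum (fun m => opA c l m z * a m) = uC l z)%C).
  (* One global choice of a(z). By uniqueness it agrees near each point of the domain with the local
     analytic family, so no compatibility of local families has to be checked. *)
  set (sol z := epsilon (inhabits (fun _ : nat => RtoC 0)) (is_sol z)).
  assert (Hsol : forall z a, injective_at (opA c) z -> is_sol z a ->
    is_sol z (sol z) /\ forall l, sol z l = a l).
  { intros z a Hinj Ha.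
    assert (H0 := epsilon_spec (inhabits (fun _ => RtoC 0)) (is_sol z) (ex_intro _ a Ha)).
    split; [exact H0|intros l].
    destruct H0 as [H1 H2], Ha as [H3 H4].
    apply (opA_solution_unique c c0 q q_range Hc z (fun l => uC l z) _ _ Hinj H1 H3 H2 H4). }
  assert (Hlocal : forall z0, injective_at (opA c) z0 ->
    exists (rho beta : R) (a : nat -> C -> C), 0 < rho <= 1 /\
      (forall l, ana z0 rho (a l) beta) /\
      forall h, Cmod h <= rho -> injective_at (opA c) (z0 + h)%C /\
        is_sol (z0 + h)%C (sol (z0 + h)%C) /\ forall l, sol (z0 + h)%C l = a l (z0 + h)%C).
  { intros z0 Hinj.
    destruct (opA_ana c c0 q q_range Hc z0) as (bA & B & HB & HA).
    destruct (uC_ana q q_range z0) as (X & HX & HU).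
    destruct (analytic_fredholm (opA c) bA B z0 uC X HA HB) as (rho & beta & a & Hr & Ha & H); auto.
    - intros l; apply ana_le with (1 := HU l).
      rewrite <- (Rmult_1_r X) at 2; apply Rmult_le_compat_l; auto.
      apply pow_q_le; auto.
    - exists rho, beta, a; split; [auto|split; [auto|]].
      intros h Hh; destruct (H h Hh) as [H1 H2]; split; auto.
      apply Hsol; auto; split; auto.
      exists beta; intros l; apply (ana_bound z0 rho); auto. }
  exists (injective_at (opA c)), (fun z w => kernelC c (sol z) w).
  assert (Hpos : forall r, 0 < r -> injective_at (opA c) (RtoC r))
    by (intros r Hr; apply (uniquely_solvable_injective c c0 q); auto).
  split; [|split; [auto|split]].
  - apply open_of_discs; intros z Hz.
    destruct (Hlocal z Hz) as (rho & beta & a & Hr & _ & H).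
    exists rho; split; [lra|]; intros h Hh; apply H; auto.
  - intros z w Hz _.
    destruct (Hlocal z Hz) as (rho & beta & a & Hr & Ha & H).
    destruct (uC_ana q q_range w) as (X & HX & HU).
    (* Near [z] the chosen solution is the analytic family [a], whose norms are bounded uniformly in
       l; the decay of u_l about [w] makes the series converge. *)
    apply analytic2_at_ext with (fun z w => Csum (fun l => c l * a l z * uC l w)%C) rho.
    + lra.
    + intros z' w' Hz'; unfold kernelC; apply Csum_ext; intros l.
      replace z' with (z + (z' - z))%C by ring.
      rewrite (proj2 (proj2 (H (z' - z)%C ltac:(lra)))); auto.
    + apply analytic2_at_Csum with rho beta (2 * c0 * X) (fun l => X * q ^ l); auto; [lra| |].
      * intros l; apply ana_shrink with 1; [lra|auto].
      * apply coeff_bnd; auto.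
  (* [K r] and the constructed kernel both solve the equation on [0, r], hence both equal its unique
     solution [k] there. *)
  - intros r s Hs; assert (Hr : 0 < r) by lra.
    destruct (huniq r Hr) as (k & _ & Huniq).
    rewrite (Huniq (K r) (hK r Hr) s) by lra.
    apply (Huniq (fun s => kernelC c (sol (RtoC r)) (RtoC s))); [|lra].
    destruct (Hlocal (RtoC r) (Hpos r Hr)) as (rho & beta & a & Hrho & Ha & H).
    assert (Hin : is_sol (RtoC r) (sol (RtoC r))).
    { replace (RtoC r) with (RtoC r + 0)%C by ring; apply H; rewrite Cmod_0; lra. }
    apply (kernelC_solves c c0 q); auto; apply Hin.
Qed.
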